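(* Let $m,n$ be positive integers, let $I\subseteq R_n$ be an ideal, and let $\mathcal{A}=\mathcal{B}_{m,I}^n$. Let $\mathcal{T}_I$ be the set of marked trees $(T,\mu)\in\overline{\mathcal{T}}_m^n$ such that whenever a node $i$ is the $m$-child of a node $j$ in $T$, we have $(i,j)\in I$. Then $\mathcal{T}_I=\overline{\mathcal{T}}_m^n(\mathcal{A})$, and the map $\overline{\Phi}_\mathcal{A}$ is a bijection from $\mathcal{T}_I$ to the set of faces of $\mathcal{A}$, under which marked trees with $k$ marked edges correspond to faces of codimension $k$.
   Context: Notation: $[a;b]=\{k\in\mathbb{Z}:a\le k\le b\}$, $[n]=[1;n]$. For distinct $i,j\in[n]$, $s\in\mathbb{Z}$, $\{x_i-x_j=s\}$ is the hyperplane $\{x\in\mathbb{R}^n: x_i-x_j=s\}$ (equal to $\{x_j-x_i=-s\}$). The $m$-Catalan arrangement $\mathcal{A}_m^n$ is the set of hyperplanes $\{x_i-x_j=s\}$ with $1\le i<j\le n$, $s\in[-m;m]$. Let $R_n=\{(i,j)\in[n]^2: i\ne j\}$. A subset $I\subseteq R_n$ is an ideal if whenever $(i,j)\in I$, $(i',j')\in R_n$, $i'\le i$ and $j'\ge j$, we have $(i',j')\in I$. Define $\mathcal{B}_{m,I}^n=\mathcal{A}_{m-1}^n\cup\{\{x_i-x_j=m\}:(i,j)\in I\}$. Let $\mathrm{Tr}_m^n$ be the set of triples $(i,j,s)$ with $i\ne j\in[n]$, $s\in[0;m]$, and ($s>0$ or $i>j$); for $\mathcal{A}\subseteq\mathcal{A}_m^n$,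 $\mathrm{Tr}_m^n(\mathcal{A})$ is the set of those triples with $\{x_i-x_j=s\}\in\mathcal{A}$. A face of an arrangement is a nonempty set obtained by choosing for each hyperplane $\{f=c\}$ one of $f<c$, $f=c$, $f>c$ and intersecting; its codimension is $n$ minus the dimension of its affine span. An $(m,n)$-tree is a rooted plane tree in which each node has exactly $m+1$ ordered children (its $0$-child, ..., $m$-child), each a node or a leaf, with $n$ nodes labeled bijectively by $[n]$ (nodes identified with labels). Node $i$ is the $s$-cadet of node $j$ if $i$ is the $s$-child of $j$ and the $t$-child of $j$ is a leaf for all $t\in[s+1;m]$; $\{i,j\}$ is then a cadet edge. For any vertex $v$ with root-to-$v$ path $v_0,\dots,v_k=v$, $\mathrm{path}_T(v)=(s_1,\dots,s_k)$ where $v_i$ is the $s_i$-child of $v_{i-1}$, and $\mathrm{drift}_T(v)=\sum s_i$. Total order $\prec_T$ on all vertices: $v\prec_T w$ iff $\mathrm{drift}_T(v)<\mathrm{drift}_T(w)$, or drifts are equal and, with $\mathrm{path}_T(v)=(s_1,\dots,s_k)$, $\mathrm{path}_T(w)=(t_1,\dots,t_\ell)$, there is $j\le k$ with $(s_1,\dots,s_j)=(t_1,\dots,t_j)$ and ($j=k$ or $s_{j+1}>t_{j+1}$). A marked $(m,n)$-tree is a pair $(T,\mu)$ with $T$ an $(m,n)$-tree and $\mu$ a set of cadet edges such that if $\{j,i\}\in\mu$ with $i$ the $0$-cadet of $j$ then $j<i$; $\overline{\mathcal{T}}_m^n$ is the set of these. $i\overset{\mu}{\sim}j$ means $i=j$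 or all edges on the tree path between $i$ and $j$ are in $\mu$; its classes are blocks. For $\mathcal{A}\subseteq\mathcal{A}_m^n$: $(T,\mu)$ is $\mathcal{A}$-connected if for each block $B$ the graph on $B$ with edges $\{i,j\}$ such that $\{x_i-x_j=\mathrm{drift}_T(i)-\mathrm{drift}_T(j)\}\in\mathcal{A}$ is connected; it satisfies the $\mathcal{A}$-cadet condition if each cadet edge $\{i,j\}\notin\mu$ with $i$ the $s$-cadet of $j$ satisfies ($s=0$ and $i<j$) or there exist $i'\overset{\mu}{\sim}i$, $j'\overset{\mu}{\sim}j$ with $\{x_{i'}-x_{j'}=\mathrm{drift}_T(i')-\mathrm{drift}_T(j')\}\in\mathcal{A}$. $\overline{\mathcal{T}}_m^n(\mathcal{A})$ is the set of $\mathcal{A}$-connected marked trees satisfying the $\mathcal{A}$-cadet condition. For a marked tree $(T,\mu)$, $\overline{\Phi}_\mathcal{A}(T,\mu)=\bigcap_{\{i,j\}\in\mu,\ i=s\text{-child of }j}\{x_i-x_j=s\}\ \cap\ \bigcap_{(i,j,s)\in\mathrm{Tr}_m^n(\mathcal{A}),\ i\not\overset{\mu}{\sim}j,\ i\prec_T v_{j,s}}\{x_i-x_j<s\}\ \cap\ \bigcap_{(i,j,s)\in\mathrm{Tr}_m^n(\mathcal{A}),\ i\not\overset{\mu}{\sim}j,\ i\succeq_T v_{j,s}}\{x_i-x_j>s\}$, where $v_{j,s}$ is the $s$-child of $j$. *)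

(* Defs.v *)
From mathcomp Require Import all_boot all_order all_algebra.
From mathcomp Require Import boolp classical_sets functions reals.

Set Implicit Arguments.
Unset Strict Implicit.
Unset Printing Implicit Defensive.

Import Order.TTheory GRing.Theory Num.Theory.
Local Open Scope classical_set_scope.
Local Open Scope ring_scope.

(* The label set [n] is 'I_n, so labels are shifted by one: only their order
   matters.  The child indices [0;m] are 'I_m.+1. *)

Section Arrangements.
Variables (R : realType) (n : nat).
Implicit Types (i j : 'I_n) (s : int) (H P F : set 'rV[R]_n).

Definition hyp i j s : set 'rV[R]_n := [set x | x 0 i - x 0 j = s%:~R].

Definition arrangement := set (set 'rV[R]_n).

Definition catalan (m : nat) : arrangement :=
  [set H | exists i j s, [/\ (i < j)%N, - m%:Z <= s <= m%:Z & H = hyp i j s]].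

Definition is_ideal (I : {set 'I_n * 'I_n}) : Prop :=
  (forall i j, (i, j) \in I -> i != j) /\
  (forall i j i' j', (i, j) \in I -> i' != j' ->
     (i' <= i)%N -> (j <= j')%N -> (i', j') \in I).

Definition ideal_arr (m : nat) (I : {set 'I_n * 'I_n}) : arrangement :=
  catalan m.-1 `|` [set H | exists i j, (i, j) \in I /\ H = hyp i j m%:Z].

(* [hyp_part H P]: H = {f = c} for some nonzero linear form f : x |-> x *m u,
   and P is one of {f < c}, {f = c}, {f > c}.  Another equation of H differs by
   a nonzero scalar and yields the same three parts. *)
Definition hyp_part H P : Prop :=
  exists (u : 'cV[R]_n) (c : R),
    [/\ u != 0,
        H = [set x | (x *m u) 0 0 = c]
      & [\/ P = [set x | (x *m u) 0 0 < c],
            P = [set x | (x *m u) 0 0 = c]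
          | P = [set x | c < (x *m u) 0 0]]].

Definition faces (A : arrangement) : set (set 'rV[R]_n) :=
  [set F | F !=set0 /\
     exists choice : set 'rV[R]_n -> set 'rV[R]_n,
       (forall H, A H -> hyp_part H (choice H)) /\
       F = \bigcap_(H in A) choice H].

Definition affine_span F : set 'rV[R]_n :=
  [set x | exists k (p : 'I_k -> 'rV[R]_n) (a : 'I_k -> R),
     [/\ forall l, F (p l), \sum_l a l = 1 & x = \sum_l a l *: p l]].

Definition has_codim F (k : nat) : Prop :=
  exists (p : 'rV[R]_n) (V : {vspace 'rV[R]_n}),
    affine_span F = [set x | x - p \in V] /\ (k + \dim V)%N = n.

End Arrangements.

Arguments hyp R {n} i j s.
Arguments ideal_arr R {n} m I.

Section Trees.
Variables m n : nat.

Inductive tree : Type :=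
  | Leaf : tree
  | Node : 'I_n -> ('I_m.+1 -> tree) -> tree.

Implicit Types (T : tree) (i j : 'I_n) (s t : 'I_m.+1).

Fixpoint labels T : seq 'I_n :=
  if T is Node i c then i :: flatten [seq labels (c s) | s <- enum 'I_m.+1]
  else [::].

Definition is_mn_tree T : bool := perm_eq (labels T) (enum 'I_n).

(* A vertex v (node or leaf) of a tree is represented by path_T(v), the sequence
   of child indices leading to it from the root. *)
Definition vertex := seq 'I_m.+1.

Fixpoint subtree T (v : vertex) : option tree :=
  match v, T with
  | [::], _ => Some T
  | s :: v', Node _ c => subtree (c s) v'
  | _ :: _, Leaf => None
  end.

Definition label_at T (v : vertex) : option 'I_n :=
  if subtree T v is Some (Node i _) then Some i else None.

Definition leaf_at T (v : vertex) : bool :=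
  if subtree T v is Some Leaf then true else false.

(* Only meaningful when i is a label of T. *)
Fixpoint node_vertex T i : vertex :=
  if T is Node l c then
    if l == i then [::]
    else if [pick s | i \in labels (c s)] is Some s
         then s :: node_vertex (c s) i
         else [::]
  else [::].

Definition child_vertex T j s : vertex := rcons (node_vertex T j) s.

Definition is_child T i s j : bool := label_at T (child_vertex T j s) == Some i.

Definition is_cadet T i s j : bool :=
  is_child T i s j &&
  [forall t : 'I_m.+1, (s < t)%N ==> leaf_at T (child_vertex T j t)].

Definition vdrift (v : vertex) : nat := \sum_(s <- v) s.

Definition drift T i : nat := vdrift (node_vertex T i).

(* Taken literally, the condition "j = k" below also relates v to itself;
   the strict order therefore excludes v = w. *)
Definition vpreceq (v w : vertex) : Prop :=
  (vdrift v < vdrift w)%N \/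
  vdrift v = vdrift w /\
  exists j : nat,
    [/\ (j <= size v)%N, take j v = take j w
      & j = size v \/
        [/\ (j < size v)%N, (j < size w)%N & (nth ord0 w j < nth ord0 v j)%N]].

Definition vprec (v w : vertex) : Prop := v <> w /\ vpreceq v w.

Definition edge i j : {set 'I_n} := [set i; j]%SET.

Definition markedtree := (tree * {set {set 'I_n}})%type.
Implicit Types M : markedtree.

Definition marked_trees : set markedtree :=
  [set M : markedtree | [/\ is_mn_tree M.1,
     forall e, e \in M.2 -> exists i j s, is_cadet M.1 i s j /\ e = edge i j
   & forall i j, is_cadet M.1 i ord0 j -> edge i j \in M.2 -> (j < i)%N]].

Definition tree_adj T : rel 'I_n :=
  fun i j => [exists s, is_child T i s j || is_child T j s i].

(* The tree path from i to j is the simple path i :: p for adjacency in T. *)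
Definition same_block M i j : Prop :=
  i = j \/
  exists p : seq 'I_n,
    [/\ path (tree_adj M.1) i p, uniq (i :: p), last i p = j
      & path (fun a b => edge a b \in M.2) i p].

Definition ideal_trees (I : {set 'I_n * 'I_n}) : set markedtree :=
  [set M : markedtree | marked_trees M /\
     forall i j, is_child M.1 i ord_max j -> (i, j) \in I].

Section TreesAndArrangements.
Variables (R : realType) (A : arrangement R n).

Definition Tr : set ('I_n * 'I_n * 'I_m.+1) :=
  [set t : 'I_n * 'I_n * 'I_m.+1 | let: (i, j, s) := t in
     [/\ i != j, (0 < s)%N || (j < i)%N & A (hyp R i j (s : nat)%:Z)]].

Definition drift_hyp T i j : set 'rV[R]_n :=
  hyp R i j ((drift T i)%:Z - (drift T j)%:Z).

Definition block_edge M i j : Prop :=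
  [/\ i != j, same_block M i j & A (drift_hyp M.1 i j)].

Definition arr_connected M : Prop :=
  forall i j, same_block M i j -> connect (fun a b => `[< block_edge M a b >]) i j.

Definition cadet_condition M : Prop :=
  forall i j s, is_cadet M.1 i s j -> edge i j \notin M.2 ->
    (s = ord0 /\ (i < j)%N) \/
    exists i' j', [/\ same_block M i' i, same_block M j' j
                    & A (drift_hyp M.1 i' j')].

Definition arr_trees : set markedtree :=
  [set M : markedtree | [/\ marked_trees M, arr_connected M & cadet_condition M]].

Definition Phi M : set 'rV[R]_n :=
  [set x : 'rV[R]_n |
    [/\ forall i j s, edge i j \in M.2 -> is_child M.1 i s j ->
          x 0 i - x 0 j = (s : nat)%:R,
        forall i j s, Tr (i, j, s) -> ~ same_block M i j ->
          vprec (node_vertex M.1 i) (child_vertex M.1 j s) ->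
          x 0 i - x 0 j < (s : nat)%:R
      & forall i j s, Tr (i, j, s) -> ~ same_block M i j ->
          vpreceq (child_vertex M.1 j s) (node_vertex M.1 i) ->
          (s : nat)%:R < x 0 i - x 0 j]].

End TreesAndArrangements.

End Trees.

Arguments ideal_trees m {n} I.
Arguments arr_trees m {n R} A.
Arguments Phi {m n R} A M.

(* Main.v *)
(* A point x lists the nodes by increasing (x_i, i). Reading the nodes in this
   order, i is attached at the last position v_{j,s} (for the order on words)
   among those with x_j + s <= x_i and s < m or (i,j) in I; the edge is marked
   when x_i = x_j + s. One checks that v_{j,s} precedes i exactly when x_j + s is
   below x_i up to the tie-breaking rule, and that ties only occur along chains
   of marked cadets, so x lies in the image of this tree. Conversely, a tree
   whose image contains x prescribes the same comparisons; if two such trees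
   first differed at the positions v < v' of a node i, then one of them would
   place i before v' and the other not. So the images of the trees partition the
   space, and each one is the sign cell of any of its points.
   An image is nonempty because the blocks are intervals of the lexicographic
   order: perturb the drifts by a small increasing function of the block. It is
   relatively open in the flat of its marked edges, which form a forest. *)
Require Import Defs.
From mathcomp Require Import all_boot all_order all_algebra.
From mathcomp Require Import boolp classical_sets functions reals.
From mathcomp Require Import zify lra.

Set Implicit Arguments.
Unset Strict Implicit.
Unset Printing Implicit Defensive.

(** * Words *)

Section Words.
Variable m : nat.
Implicit Types (v w u : vertex m) (s t : 'I_m.+1).

(** Depth-first order: a vertex comes before its descendants, and the subtrees of its children
    follow from the last child to the first. *)
Fixpoint lexle v w : bool :=
  match v, w with
  | [::], _ => true
  | _ :: _, [::] => false
  | a :: v', b :: w' => (b < a)%N || (a == b) && lexle v' w'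
  end.

Definition vle v w := (vdrift v < vdrift w)%N || (vdrift v == vdrift w) && lexle v w.

Lemma vdrift_nil : vdrift ([::] : vertex m) = 0%N.
Proof. by rewrite /vdrift big_nil. Qed.

Lemma vdrift_cons s v : vdrift (s :: v) = (s + vdrift v)%N.
Proof. by rewrite /vdrift big_cons. Qed.

Lemma vdrift_rcons v s : vdrift (rcons v s) = (vdrift v + s)%N.
Proof. by rewrite /vdrift -cats1 big_cat big_seq1. Qed.

Lemma vdrift_cat v w : vdrift (v ++ w) = (vdrift v + vdrift w)%N.
Proof. by rewrite /vdrift big_cat. Qed.

Lemma lexle_refl : reflexive lexle.
Proof. by elim=> //= a v ->; rewrite eqxx orbT. Qed.

Lemma lexle_trans : transitive lexle.
Proof.
move=> w v; elim: v w => [|a v IH] [|b w] [|c u] //=.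
case/orP=> [ba|/andP[/eqP<- vw]]; case/orP=> [cb|/andP[/eqP<- wu]].
- by rewrite (ltn_trans cb ba).
- by rewrite ba.
- by rewrite cb.
- by rewrite eqxx (IH _ _ vw wu) orbT.
Qed.

Lemma lexle_anti v w : lexle v w -> lexle w v -> v = w.
Proof.
elim: v w => [|a v IH] [|b w] //=.
case/orP=> [ba|/andP[/eqP<- vw]]; case/orP=> [cb|/andP[/eqP E wu]].
- by move: (ltn_trans cb ba); rewrite ltnn.
- by move: ba; rewrite E ltnn.
- by move: cb; rewrite ltnn.
- by rewrite (IH _ vw wu).
Qed.

Lemma lexle_total v w : lexle v w || lexle w v.
Proof.
elim: v w => [|a v IH] [|b w] //=.
case: (ltngtP a b) => [||ab] //=; first by rewrite orbT.
by rewrite (val_inj ab) eqxx /= IH.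
Qed.

Lemma lexle_catr v w : lexle v (v ++ w).
Proof. by elim: v => //= a v ->; rewrite eqxx orbT. Qed.

Lemma lexle_rcons v s : lexle v (rcons v s).
Proof. by rewrite -cats1 lexle_catr. Qed.

(** Depth-first traversal visits only the subtrees of the [t]-children of [v] with [s < t] between
    [v] and its [s]-child. *)
Lemma lexle_between v w s : lexle v w -> lexle w (rcons v s) ->
  [\/ w = v, w = rcons v s | exists t u, (s < t)%N /\ w = v ++ t :: u].
Proof.
elim: v w => [|a v IH] [|b w] //=; first by constructor 1.
- move=> _; case/orP=> [sb|/andP[/eqP-> ]]; first by constructor 3; exists b, w.
  by case: w => // _; constructor 2.
- case/orP=> [ba|/andP[/eqP-> vw]].
    case/orP=> [ab|/andP[/eqP E _]]; first by move: (ltn_trans ab ba); rewrite ltnn.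
    by move: ba; rewrite E ltnn.
  rewrite ltnn eqxx /= => /(IH _ vw)[->|->|[t [u [st ->]]]];
    [by constructor 1|by constructor 2|by constructor 3; exists t, u].
Qed.

Lemma vle_refl : reflexive vle.
Proof. by move=> v; rewrite /vle eqxx lexle_refl orbT. Qed.

Lemma vle_trans : transitive vle.
Proof.
rewrite /vle => w v u.
case/orP=> [vw|/andP[/eqP-> vw]]; case/orP=> [wu|/andP[/eqP E wu]].
- by rewrite (ltn_trans vw wu).
- by rewrite -E vw.
- by rewrite wu.
- by rewrite E eqxx (lexle_trans vw wu) orbT.
Qed.

Lemma vle_anti v w : vle v w -> vle w v -> v = w.
Proof.
rewrite /vle.
by case/orP=> [vw|/andP[/eqP E vw]] /orP[wv|/andP[/eqP E' wv]];
  try lia; apply: lexle_anti.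
Qed.

Lemma vle_total v w : vle v w || vle w v.
Proof. by rewrite /vle; have := lexle_total v w; case: ltngtP. Qed.

Lemma vleNge v w : ~~ vle v w -> vle w v.
Proof. by move=> H; move: (vle_total v w); rewrite (negbTE H). Qed.

Lemma vle_nil v : vle [::] v.
Proof. by rewrite /vle vdrift_nil /= andbT; lia. Qed.

Lemma vle_rcons v s : vle v (rcons v s).
Proof. by rewrite /vle vdrift_rcons lexle_rcons andbT; lia. Qed.

Lemma rcons_neq v s : rcons v s <> v.
Proof. by move/(congr1 size); rewrite size_rcons => /eqP; rewrite eqn_leq ltnn. Qed.

Lemma vle_rconsN v s : ~~ vle (rcons v s) v.
Proof. by apply/negP => /vle_anti/(_ (vle_rcons v s))/rcons_neq. Qed.

(** A trailing 0 keeps the drift, and a word of the same drift extending [v] has only zeros after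
    [v]; so the 0-child is the immediate successor of [v]. *)
Lemma vle_rcons0 v w : v <> w -> vle v w -> vle (rcons v ord0) w.
Proof.
rewrite /vle vdrift_rcons addn0 => vw /orP[->//|/andP[/eqP E L]].
rewrite E eqxx ltnn /=.
elim: v w vw E L => [|a v IH] [|b w] vw //=.
  by rewrite vdrift_nil vdrift_cons andbT => E _; rewrite -val_eqE /=; lia.
rewrite !vdrift_cons => E /orP[->//|/andP[/eqP Eab L]].
rewrite Eab in vw E *.
rewrite eqxx ltnn /= IH //; last lia.
by move=> Evw; apply: vw; rewrite Evw.
Qed.

(* Shifting both values [x_j + s] and [x_j' + s'] by [s'] preserves the order. *)
Lemma vle_shift v w s s' t : v <> w -> (t + s' = s)%N ->
  vle (rcons v s) (rcons w s') = vle (rcons v t) w.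
Proof.
move=> vw ts; rewrite /vle !vdrift_rcons.
have -> : (vdrift v + s < vdrift w + s')%N = (vdrift v + t < vdrift w)%N by lia.
have -> : (vdrift v + s == vdrift w + s') = (vdrift v + t == vdrift w).
  by apply/eqP/eqP; lia.
case: eqP => //= E; congr (_ || _).
elim: v w vw E => [|a v IH] [|b w] vw //=.
- rewrite vdrift_nil vdrift_cons andbT => E.
  by apply/orP/orP => _; apply/orP; rewrite -val_eqE /=; lia.
- rewrite vdrift_nil vdrift_cons => E.
  by case: v {IH vw} E => [|c v] /= E; rewrite andbF orbF; apply/negbTE; lia.
- rewrite !vdrift_cons => E; case: eqP => //= Eab; congr (_ || _); apply: IH.
    by move=> Evw; apply: vw; rewrite Evw Eab.
  by rewrite Eab in E; lia.
Qed.

(** At equal drifts the first letter of [w] is at most [s], so the tie-break never favours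
    [v ++ w]. *)
Lemma vle_rcons_cat v w s : w <> [::] ->
  vle (rcons v s) (v ++ w) = (s <= vdrift w)%N.
Proof.
move=> w0; rewrite /vle vdrift_rcons vdrift_cat ltn_add2l eqn_add2l.
case: ltngtP => //= E; elim: v => [|a v IH] /=; last by rewrite ltnn eqxx.
case: w w0 E => [|b w] //= _; rewrite vdrift_cons => E.
by rewrite andbT -val_eqE /=; lia.
Qed.

Lemma vle_catr v w : vle v (v ++ w).
Proof. by rewrite /vle vdrift_cat lexle_catr andbT; lia. Qed.

Lemma lexle_cat2 u v w : lexle (u ++ v) (u ++ w) = lexle v w.
Proof. by elim: u => //= a u ->; rewrite ltnn eqxx. Qed.

(** The companion of [vle_shift] when the second index is the larger: exchanging the two words gives
    a strict comparison, since they cannot coincide. *)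
Lemma vle_shiftN v w s s' t : v <> w -> (t + s = s')%N ->
  vle (rcons v s) (rcons w s') -> ~~ vle (rcons w t) v.
Proof.
move=> vw ts h; rewrite -(vle_shift (s := s') (s' := s)) //; last exact/nesym.
by apply/negP => /(vle_anti h)/rcons_inj[].
Qed.

(** Otherwise [v] would lie strictly between [w] and its [s]-child, hence below a [t]-child of [w]
    with [s < t], and its drift would be too large. *)
Lemma lexle_ofvle v w s : vdrift v = (vdrift w + s)%N -> v <> rcons w s ->
  lexle v (rcons w s) -> lexle v w.
Proof.
move=> E ne L; case/orP: (lexle_total v w) => // wv.
case: (lexle_between wv L) => // [->|[t [u [st Ev]]]]; first exact: lexle_refl.
by rewrite Ev vdrift_cat vdrift_cons in E; lia.
Qed.

Lemma vpreceqP v w : vpreceq v w <-> vle v w.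
Proof.
rewrite /vpreceq /vle; split=> [[->//|[-> [k [kv E H]]]]|].
  rewrite eqxx ltnn /=; elim: v w k kv E H => [|a v IH] [|b w] [|k] //=.
  - by move=> _ _ [//|[_]]; rewrite ltn0.
  - by move=> _ _ [//|[_ _ ->]].
  - rewrite ltnS => kv [-> E] H; rewrite eqxx ltnn /=; apply: (IH _ k kv E).
    case: H => [[->]|[H1 H2 H3]]; first by left.
    by right.
case/orP => [H|/andP[/eqP H L]]; [by left|right; split=> // {H}].
elim: v w L => [|a v IH] [|b w] //=; first by exists 0%N; split=> //; left.
  by exists 0%N; split=> //; left.
case/orP=> [ba|/andP[/eqP-> /IH[k [kv E H]]]]; first by exists 0%N; split=> //; right.
by exists k.+1; split=> //=; [rewrite E|case: H => [->|]; [left|right]].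
Qed.

Lemma vprecP v w : vprec v w <-> ~~ vle w v.
Proof.
rewrite /vprec; split=> [[ne /vpreceqP H]|H].
  by apply/negP => H'; apply: ne; apply: vle_anti.
split; last by apply/vpreceqP/vleNge.
by move=> E; rewrite E vle_refl in H.
Qed.

Definition vmax v w := if vle v w then w else v.

Lemma vle_bigmax (J : eqType) (r : seq J) (P : pred J) (F : J -> vertex m) c :
  c \in r -> P c -> vle (F c) (\big[vmax/[::]]_(d <- r | P d) F d).
Proof.
have ub v w : vle v (vmax v w) /\ vle w (vmax v w).
  by rewrite /vmax; case: ifPn => [h|/vleNge h]; split=> //; apply: vle_refl.
elim: r => // d r IH; rewrite inE big_cons => /orP[/eqP<- ->|cr Pc].
  exact: (ub _ _).1.
by case: (P d); [apply: vle_trans (ub _ _).2|]; apply: IH.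
Qed.

Lemma bigmax_ex (J : Type) (r : seq J) (P : pred J) (F : J -> vertex m) :
  let v := \big[vmax/[::]]_(d <- r | P d) F d in
  v = [::] \/ exists2 d, P d & v = F d.
Proof.
apply: (big_ind (fun v => v = [::] \/ exists2 d, P d & v = F d)).
- by left.
- by move=> v w Hv Hw; rewrite /vmax; case: ifP.
- by move=> d Pd; right; exists d.
Qed.

End Words.

(** * Trees and the words of their nodes *)

Section TreeWords.
Variables m n : nat.
Implicit Types (T : tree m n) (i j k l : 'I_n) (s t : 'I_m.+1) (v w : vertex m).

Lemma label_at_cons l (c : 'I_m.+1 -> tree m n) s v :
  label_at (Node l c) (s :: v) = label_at (c s) v.
Proof. by []. Qed.

Lemma labels_labelP T i : (exists v, label_at T v = Some i) <-> i \in labels T.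
Proof.
elim: T => [|l c IH]; first by split=> // -[[|s v]].
split=> [[[|s v]]|]; rewrite /= inE.
- by case=> ->; rewrite eqxx.
- rewrite label_at_cons => H; apply/orP; right; apply/flatten_mapP.
  by exists s; [rewrite mem_enum|apply/IH; exists v].
case/orP=> [/eqP->|/flatten_mapP[s _ /IH[v E]]]; first by exists [::].
by exists (s :: v).
Qed.

Lemma count_labels_node l (c : 'I_m.+1 -> tree m n) i :
  count_mem i (labels (Node l c)) = ((l == i) + \sum_s count_mem i (labels (c s)))%N.
Proof. by rewrite /= count_flatten sumnE !big_map -[in RHS]big_enum enumT. Qed.

Lemma count_labels_le1 T i :
  (count_mem i (labels T) <= 1)%N <->
  (forall v w, label_at T v = Some i -> label_at T w = Some i -> v = w).
Proof.
elim: T => [|l c IH]; first by split=> // _ [].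
rewrite count_labels_node; split=> [H|H].
- have mem0 s v : label_at (c s) v = Some i -> (0 < count_mem i (labels (c s)))%N.
    by move=> E; rewrite -has_count has_pred1; apply/labels_labelP; exists v.
  have sum0 s : (count_mem i (labels (c s)) <= \sum_s count_mem i (labels (c s)))%N.
    by rewrite (bigD1 s) //= leq_addr.
  move=> [|s v] [|t w] //; rewrite ?label_at_cons.
  + case=> E /mem0 H'; move: H; rewrite E eqxx add1n ltnS leqNgt.
    by rewrite (leq_trans H') // sum0.
  + move=> /mem0 H' [E]; move: H; rewrite E eqxx add1n ltnS leqNgt.
    by rewrite (leq_trans H') // sum0.
  + move=> Hs Ht; case: (eqVneq s t) => [E|st].
      rewrite -E in Ht *; congr (_ :: _); apply: (IH s).1 Hs Ht.
      by apply: leq_trans (sum0 s) _; apply: leq_trans H; rewrite leq_addl.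
    move: H; rewrite (bigD1 s) //= (bigD1 t) 1?eq_sym //=.
    move: (mem0 _ _ Hs) (mem0 _ _ Ht); set a := count _ _; set b := count _ _.
    by move=> a0 b0; rewrite addnCA [(b + _)%N]addnC; case: a a0 => // a _; case: b b0 => // b _; lia.
- have le1 s : (count_mem i (labels (c s)) <= 1)%N.
    by apply/IH => v w Hv Hw; have := H (s :: v) (s :: w) Hv Hw; case.
  case: (eqVneq l i) => [E|li].
    rewrite big1 // => s _; apply/count_memPn/negP => /labels_labelP[v Hv].
    by have := H [::] (s :: v); rewrite label_at_cons Hv /label_at /= E => /(_ erefl erefl).
  rewrite add0n; case: (pickP (fun s => i \in labels (c s))) => [s si|no].
    rewrite (bigD1 s) //= big1 ?addn0 // => t ts.
    apply/count_memPn/negP => /labels_labelP[w Hw]; case/labels_labelP: si => v Hv.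
    have := H (s :: v) (t :: w) Hv Hw; case=> st _.
    by rewrite st eqxx in ts.
  by rewrite big1 // => s _; apply/count_memPn; rewrite no.
Qed.

Lemma is_mn_treeP T :
  is_mn_tree T <->
  (forall i, exists v, label_at T v = Some i) /\
  (forall i v w, label_at T v = Some i -> label_at T w = Some i -> v = w).
Proof.
split=> [H|[ex un]].
  have cnt i : count_mem i (labels T) = 1%N.
    by rewrite (permP H) (count_uniq_mem _ (enum_uniq _)) mem_enum.
  split=> i; last by apply/count_labels_le1; rewrite cnt.
  by apply/labels_labelP; rewrite -has_pred1 has_count cnt.
apply/allP => i _ /=; apply/eqP.
rewrite (count_uniq_mem _ (enum_uniq _)) mem_enum.
apply/eqP; rewrite eqn_leq -has_count has_pred1; apply/andP; split.
  by apply/count_labels_le1/un.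
by apply/labels_labelP.
Qed.

Lemma label_at_node_vertex T i :
  i \in labels T -> label_at T (node_vertex T i) = Some i.
Proof.
elim: T => [|l c IH] //=; case: eqP => [->//|ne].
rewrite inE eq_sym; case: eqP => //= _ /flatten_mapP[s _ Hs].
case: pickP => [t Ht|/(_ s)]; last by rewrite Hs.
by rewrite label_at_cons IH.
Qed.

Lemma label_atP T : is_mn_tree T ->
  forall v i, label_at T v = Some i <-> v = node_vertex T i.
Proof.
move=> H v i; have Hi : label_at T (node_vertex T i) = Some i.
  by apply: label_at_node_vertex; rewrite (perm_mem H) mem_enum.
split=> [Hv|->//].
by case/is_mn_treeP: H => _ /(_ i _ _ Hv Hi).
Qed.

Lemma node_vertex_inj T : is_mn_tree T -> injective (node_vertex T).
Proof.
move=> H i j E; have /label_atP := erefl (node_vertex T i) => /(_ H) Hi.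
have /label_atP := erefl (node_vertex T j) => /(_ H).
by rewrite -E Hi => -[].
Qed.

Lemma subtree_cat T v w :
  subtree T (v ++ w) = obind (fun U => subtree U w) (subtree T v).
Proof. by elim: v T => [|s v IH] [|l c] //=. Qed.

Lemma label_at_prefix T v w i : label_at T (v ++ w) = Some i ->
  exists j, label_at T v = Some j.
Proof.
rewrite /label_at subtree_cat.
case: (subtree T v) => [[|l c]|] //=; last by exists l.
by case: w.
Qed.

Lemma node_vertex_prefix T : is_mn_tree T ->
  forall i v w, node_vertex T i = v ++ w -> exists j, node_vertex T j = v.
Proof.
move=> H i v w /esym/(label_atP H)/label_at_prefix[j /(label_atP H)->].
by exists j.
Qed.

Lemma node_vertex_parent T : is_mn_tree T ->
  forall i, node_vertex T i = [::] \/
            exists j s, node_vertex T i = rcons (node_vertex T j) s.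
Proof.
move=> H i; case/lastP E: (node_vertex T i) => [|v s]; first by left.
right; have [j Ej] : exists j, node_vertex T j = v.
  by apply: (node_vertex_prefix H (i := i) (w := [:: s])); rewrite cats1.
by exists j, s; rewrite Ej.
Qed.

Lemma is_childP T : is_mn_tree T ->
  forall i s j, is_child T i s j <-> node_vertex T i = rcons (node_vertex T j) s.
Proof.
move=> H i s j; rewrite /is_child /child_vertex; split=> [/eqP/(label_atP H)->//|<-].
by apply/eqP/(label_atP H).
Qed.

Lemma leaf_atP T : is_mn_tree T -> forall j t,
  leaf_at T (child_vertex T j t) <->
  (forall k, node_vertex T k <> rcons (node_vertex T j) t).
Proof.
move=> H j t; rewrite /child_vertex.
have /(label_atP H) := erefl (node_vertex T j); rewrite /label_at.
have lab k : node_vertex T k = rcons (node_vertex T j) t <->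
    label_at T (rcons (node_vertex T j) t) = Some k.
  by rewrite (label_atP H); split=> ->.
rewrite /leaf_at -cats1 subtree_cat.
case E: (subtree T (node_vertex T j)) => [[|l c]|] //= _.
case Ec: (c t) => [|l' c']; split=> //.
  move=> _ k; rewrite cats1 lab /label_at -cats1 subtree_cat E /= Ec //.
move=> /(_ l'); rewrite cats1 lab /label_at -cats1 subtree_cat E /= Ec; exact.
Qed.

Lemma is_cadetP T : is_mn_tree T -> forall i s j,
  is_cadet T i s j <->
  node_vertex T i = rcons (node_vertex T j) s /\
  (forall t k, (s < t)%N -> node_vertex T k <> rcons (node_vertex T j) t).
Proof.
move=> H i s j; rewrite /is_cadet; split.
  case/andP=> /(is_childP H) E /forallP L; split=> // t k st.
  by move: (L t); rewrite st => /(leaf_atP H)/(_ k).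
case=> /(is_childP H)-> L /=; apply/forallP => t; apply/implyP => st.
by apply/(leaf_atP H) => k; apply: L.
Qed.

Lemma drift_child T : is_mn_tree T -> forall i s j,
  is_child T i s j -> drift T i = (drift T j + s)%N.
Proof. by move=> H i s j /(is_childP H); rewrite /drift => ->; rewrite vdrift_rcons. Qed.

Lemma tree_ext T T' : (forall v, label_at T v = label_at T' v) -> T = T'.
Proof.
elim: T T' => [|l c IH] [|l' c'] E //; [by move: (E [::])|by move: (E [::])|].
have [->] : Some l = Some l' by apply: (E [::]).
congr (Node _ _); apply: funext => s; apply: IH => v.
exact: (E (s :: v)).
Qed.

Lemma node_vertex_ext T T' : is_mn_tree T -> is_mn_tree T' ->
  node_vertex T =1 node_vertex T' -> T = T'.
Proof.
move=> H H' E; apply: tree_ext => v.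
case L: (label_at T v) => [i|].
  by apply/esym/(label_atP H'); rewrite -E; apply/(label_atP H).
case L': (label_at T' v) => [i|] //.
by move/(label_atP H'): L'; rewrite -E => /(label_atP H); rewrite L.
Qed.

Section Build.
Variable p : 'I_n -> vertex m.

(** The tree with each node [i] at the word [p i], seen from the word [v] and cut off at depth [d];
    the bound makes the recursion structural. *)
Fixpoint build (d : nat) (v : vertex m) : tree m n :=
  if d is d'.+1 then
    if [pick i | p i == v] is Some i then Node i (fun s => build d' (rcons v s))
    else Leaf m n
  else Leaf m n.

Hypothesis p_inj : injective p.
Hypothesis p_prefix : forall i v w, p i = v ++ w -> exists j, p j = v.

Lemma label_at_build d v w i : (size w < d)%N ->
  label_at (build d v) w = Some i <-> p i = v ++ w.
Proof.
elim: d v w => [|d IH] v w //= dw.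
case: pickP => [k /eqP Ek|no].
  case: w dw => [|s w] dw.
    by rewrite cats0 -Ek /label_at /=; split=> [[->]|/p_inj->].
  by rewrite label_at_cons IH ?cat_rcons.
split=> [|E]; first by case: w dw.
by have [j Ej] := p_prefix E; move: (no j); rewrite Ej eqxx.
Qed.

Lemma size_label_at_build d v w i :
  label_at (build d v) w = Some i -> (size w < d)%N.
Proof.
elim: d v w => [|d IH] v [|s w] //=.
by case: pickP => [k _|_] //=; rewrite label_at_cons => /IH.
Qed.

Lemma build_tree : exists T, is_mn_tree T /\ node_vertex T =1 p.
Proof.
(* One more than the longest word, so the cut-off loses no node. *)
pose d := (\max_i size (p i)).+1.
have lab w i : label_at (build d [::]) w = Some i <-> p i = w.
  split=> [L|E]; first exact/(label_at_build [::] i (size_label_at_build L)).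
  by apply/label_at_build => //; rewrite -E ltnS leq_bigmax.
exists (build d [::]); have H : is_mn_tree (build d [::]).
  apply/is_mn_treeP; split=> [i|i v w /lab<- /lab<-//].
  by exists (p i); apply/lab.
by split=> // i; apply/esym/(label_atP H)/lab.
Qed.

End Build.
End TreeWords.

(** * Blocks *)

Section Blocks.
Variables m n : nat.
Implicit Types (i j k l : 'I_n) (s t : 'I_m.+1) (v w : vertex m).

Lemma edgeC i j : edge i j = edge j i.
Proof. exact: finset.setUC. Qed.

Lemma edge_eq i j a b : edge i j = edge a b ->
  (i = a /\ j = b) \/ (i = b /\ j = a).
Proof.
move=> E; have : i \in edge a b by rewrite -E !inE eqxx.
have : j \in edge a b by rewrite -E !inE eqxx orbT.
have : a \in edge i j by rewrite E !inE eqxx.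
have : b \in edge i j by rewrite E !inE eqxx orbT.
by rewrite !inE => /orP[]/eqP ? /orP[]/eqP ? /orP[]/eqP ? /orP[]/eqP ?; subst; auto.
Qed.

Variable M : markedtree m n.
Hypothesis HM : marked_trees M.
Local Notation T := M.1.
Local Notation p := (node_vertex M.1).

Lemma marked_mn : is_mn_tree T.
Proof. by case: HM. Qed.
Local Hint Resolve marked_mn : core.

Lemma not_both_child i j s t : is_child T i s j -> is_child T j t i -> False.
Proof.
move=> /(is_childP marked_mn) Ei /(is_childP marked_mn) Ej.
by move/(congr1 size): Ei; rewrite Ej !size_rcons; lia.
Qed.

Lemma cadet_child i s j : is_cadet T i s j -> is_child T i s j.
Proof. by case/andP. Qed.

Lemma mark_cadet i s j : edge i j \in M.2 -> is_child T i s j -> is_cadet T i s j.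
Proof.
case: HM => H cad _ /cad[a [b [t [C E]]]] ch.
case: (edge_eq E) => [[Ea Eb]|[Ea Eb]]; subst a b; last first.
  by case: (not_both_child ch (cadet_child C)).
suff -> : s = t by [].
move/(is_childP H): ch; move/cadet_child/(is_childP H): C => -> /rcons_inj[->] //.
Qed.

(** Marked edges oriented from parent to child; the blocks are the maximal chains of this
    relation. *)
Definition mchild : rel 'I_n :=
  fun j i => [exists s, is_child T i s j] && (edge i j \in M.2).

Lemma mchildP j i : mchild j i <-> exists s, is_cadet T i s j /\ edge i j \in M.2.
Proof.
split=> [/andP[/existsP[s ch] e]|[s [c e]]].
  by exists s; split=> //; apply: mark_cadet.
by rewrite /mchild e andbT; apply/existsP; exists s; apply: cadet_child.
Qed.

Lemma mark_mchild i j : edge i j \in M.2 -> mchild j i \/ mchild i j.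
Proof.
case: HM => H cad _ e; case: (cad _ e) => a [b [s [C E]]].
by case: (edge_eq E) => -[-> ->]; [left|right]; apply/mchildP; exists s;
  rewrite -E.
Qed.

Lemma mchild_word j i : mchild j i -> exists s, p i = rcons (p j) s.
Proof. by move/mchildP=> [s [/cadet_child/(is_childP marked_mn) E _]]; exists s. Qed.

Lemma mchild_parent j j' i : mchild j i -> mchild j' i -> j = j'.
Proof.
move=> /mchild_word[s E] /mchild_word[t]; rewrite E => /rcons_inj[E' _].
exact: (node_vertex_inj marked_mn).
Qed.

(** Marked edges are cadet edges, and all children beyond a cadet are leaves. *)
Lemma mchild_child j i i' : mchild j i -> mchild j i' -> i = i'.
Proof.
move=> /mchildP[s [/(is_cadetP marked_mn)[E L] _]].
move=> /mchildP[t [/(is_cadetP marked_mn)[E' L'] _]].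
case: (ltngtP s t) => st; first by case: (L _ i' st).
  by case: (L' _ i st).
by apply: (node_vertex_inj marked_mn); rewrite E E' (val_inj st).
Qed.

(** A simple marked path cannot turn: a node has at most one parent and one marked child, so a
    change of direction would revisit a node. *)
Lemma same_blockP i j :
  same_block M i j <-> connect mchild i j || connect mchild j i.
Proof.
have Hrev (e : rel 'I_n) a b : (forall a b, e a b -> tree_adj T a b /\ edge a b \in M.2) ->
    connect e a b -> same_block M a b.
  move=> He /connectP[q Hq ->]; case/shortenP: Hq => q' Hq' U _.
  right; exists q'; split=> //; first by apply: sub_path Hq' => ? ? /He[].
  by apply: sub_path Hq' => ? ? /He[].
split; last first.
  case/orP=> H; first (apply: Hrev H => a b /andP[/existsP[s ch] e]).
    split; last by rewrite edgeC.
    by apply/existsP; exists s; rewrite ch orbT.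
  have : connect (fun a b => mchild b a) i j by rewrite connect_rev.
  apply: Hrev => a b /andP[/existsP[s ch] e]; split=> //.
  by apply/existsP; exists s; rewrite ch.
case=> [->|[q [_ U L e]]]; first by rewrite connect0.
suff : path mchild i q \/ path (fun a b => mchild b a) i q.
  case=> P; first by apply/orP; left; apply/connectP; exists q.
  apply/orP; right; have : connect (fun a b => mchild b a) i j by apply/connectP; exists q.
  by rewrite connect_rev.
elim: q i U e {L} => [|a q IH] i /=; first by left.
rewrite inE negb_or -andbA => /and4P[ia iq aq uq] /andP[e P].
have {IH} := IH a; rewrite /= aq uq => /(_ isT P).
case: (mark_mchild e) => Hm; case=> Hq.
- case: q Hq iq {P uq aq} => [|b q] /=; first by rewrite Hm; right.
  case/andP=> ab _; rewrite inE (mchild_child Hm ab) eqxx //.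
- by right; rewrite Hm.
- by left; rewrite Hm.
- case: q Hq iq {P uq aq} => [|b q] /=; first by rewrite Hm; left.
  case/andP=> ab _; rewrite inE (mchild_parent Hm ab) eqxx //.
Qed.

Lemma same_block_sym i j : same_block M i j -> same_block M j i.
Proof. by move/same_blockP; rewrite orbC => /same_blockP. Qed.

Lemma mchain_ind (P : 'I_n -> 'I_n -> Prop) :
  (forall i, P i i) ->
  (forall j k i, mchild j k -> connect mchild k i -> P k i -> P j i) ->
  forall j i, connect mchild j i -> P j i.
Proof.
move=> P0 PS j i /connectP[q Hq ->] {i}.
elim: q j Hq => [|k q IH] j //= /andP[jk Hq].
by apply: PS jk _ (IH _ Hq); apply/connectP; exists q.
Qed.

Lemma mchain_word j i : connect mchild j i -> exists w, p i = p j ++ w.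
Proof.
move: j i; apply: mchain_ind => [i|j k i /mchild_word[s E] _ [w ->]].
  by exists [::]; rewrite cats0.
by exists (s :: w); rewrite E cat_rcons.
Qed.

Lemma mchain_anti i j : connect mchild i j -> connect mchild j i -> i = j.
Proof.
move=> /mchain_word[w E] /mchain_word[u E'].
apply: (node_vertex_inj marked_mn); move: E'; rewrite E -catA -[LHS]cats0.
move/eqP; rewrite eqseq_cat // eqxx /= => /eqP.
by case: w {E} => //; rewrite cats0.
Qed.

Lemma mchain_drift_le j i : connect mchild j i -> (drift T j <= drift T i)%N.
Proof. by case/mchain_word=> w; rewrite /drift => ->; rewrite vdrift_cat leq_addr. Qed.

(** Equal drifts force every edge of the chain to be a 0-cadet edge, where the marking rule makes
    labels increase downwards. *)
Lemma mchain_label j i : connect mchild j i -> drift T i = drift T j -> (j <= i)%N.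
Proof.
move: j i; apply: mchain_ind => // j k i jk ki IH E.
case/mchildP: (jk) => s [C e].
have Ek := drift_child marked_mn (cadet_child C).
have ki' := mchain_drift_le ki.
have s0 : s = ord0 by apply: val_inj => /=; lia.
case: HM => _ _ /(_ k j); rewrite -s0 => /(_ C e) jk'.
by apply: leq_trans (ltnW jk') (IH _); lia.
Qed.

Lemma mchain_value (R : realType) (x : 'I_n -> R) :
  (forall i j s, edge i j \in M.2 -> is_child T i s j -> (x i - x j = (s : nat)%:R)%R) ->
  forall j i, connect mchild j i -> (x i - x j = (drift T i)%:R - (drift T j)%:R)%R.
Proof.
move=> H; apply: mchain_ind => [i|j k i jk _ IH]; first by lra.
case/mchildP: jk => s [C e]; have Ek := drift_child marked_mn (cadet_child C).
have := H _ _ _ e (cadet_child C); move: IH; rewrite Ek GRing.natrD; lra.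
Qed.

Lemma mchain_first j i : connect mchild j i -> j != i ->
  exists2 k, mchild j k & connect mchild k i.
Proof.
move: j i; apply: mchain_ind => [i|j k i jk ki _ _]; first by rewrite eqxx.
by exists k.
Qed.

Lemma mchain_last j i : connect mchild j i -> j != i ->
  exists2 k, mchild k i & connect mchild j k.
Proof.
move: j i; apply: mchain_ind => [i|j k i jk ki IH ji]; first by rewrite eqxx.
case: (eqVneq k i) => [E|/IH[l li kl]]; first by exists j; rewrite -?E.
by exists l => //; apply: connect_trans kl; apply: connect1.
Qed.

(** Words grow by one letter at each step of the chain from [j] to [i], so this chain is a single
    edge. *)
Lemma mark_block i s j : same_block M i j -> is_child T i s j -> edge i j \in M.2.
Proof.
move=> /same_blockP B /(is_childP marked_mn) E; case/orP: B => [/mchain_word[w Ew]|B].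
  by move/(congr1 size): Ew; rewrite E size_cat size_rcons; lia.
case: (mchain_first B) => [|k jk ki].
  by apply/eqP => Eij; rewrite Eij in E; case: (rcons_neq (esym E)).
suff -> : i = k by case/andP: jk.
case/mchild_word: jk => t Et; case/mchain_word: ki => w.
rewrite E Et => Ew; have w0 : w = [::].
  by move/(congr1 size): Ew; rewrite size_cat !size_rcons; case: w => //= *; lia.
by apply: (node_vertex_inj marked_mn); rewrite E Et Ew w0 cats0.
Qed.

(* A block is an interval of the nodes in the order [lexle]: there, a node is
   immediately followed by its cadet. *)
Lemma mchain_contiguous j i k : connect mchild j i ->
  lexle (p j) (p k) -> lexle (p k) (p i) -> connect mchild j k /\ connect mchild k i.
Proof.
move: j i; apply: mchain_ind => [i ik ki|j l i jl li IH jk ki].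
  by rewrite (node_vertex_inj marked_mn (lexle_anti ki ik)).
have conn1 : connect mchild j l by apply: connect1.
case/orP: (lexle_total (p l) (p k)) => [lk|kl].
  by case: (IH lk ki) => lk' ki'; split=> //; apply: connect_trans conn1 lk'.
case/mchildP: jl => s [/(is_cadetP marked_mn)[E L] _].
rewrite E in kl; case: (lexle_between jk kl) => [Ek|Ek|[t [u [st Ek]]]].
- rewrite (node_vertex_inj marked_mn Ek); split=> //.
  exact: connect_trans conn1 li.
- by rewrite -E in Ek; rewrite (node_vertex_inj marked_mn Ek).
- rewrite -cat_rcons in Ek; case: (node_vertex_prefix marked_mn Ek) => k' /L.
  by move/(_ st).
Qed.

Definition linked i := [exists j, mchild j i].

Lemma mchain_top i : exists2 j, ~~ linked j & connect mchild j i.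
Proof.
have [k] := ubnP (size (p i)); elim: k i => // k IH i; rewrite ltnS => si.
case: (boolP (linked i)) => [/existsP[j ji]|]; last by exists i.
case/mchild_word: (ji) => s E; rewrite E size_rcons in si.
have [l Ll lj] := IH j si; exists l => //.
by apply: connect_trans lj (connect1 ji).
Qed.

End Blocks.

(** * Hyperplanes, faces and ideal arrangements *)

Section Hyperplanes.
Import Order.TTheory GRing.Theory Num.Theory.
Local Open Scope classical_set_scope.
Local Open Scope ring_scope.
Variables (R : realType) (n : nat).
Implicit Types (i j k : 'I_n) (s : int) (x y : 'rV[R]_n) (H P F : set 'rV[R]_n).

Definition gap i j s x : R := x 0 i - x 0 j - s%:~R.

Lemma hypE i j s x : hyp R i j s x <-> gap i j s x = 0.
Proof. by rewrite /gap /hyp /=; split=> [->|/eqP]; rewrite ?subrr // subr_eq0 => /eqP. Qed.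

Lemma gapN i j s x : gap j i (- s) x = - gap i j s x.
Proof. by rewrite /gap mulrNz; lra. Qed.

Lemma hyp_swap i j s : hyp R i j s = hyp R j i (- s).
Proof.
apply/seteqP; split=> x /hypE E; apply/hypE; first by rewrite gapN E oppr0.
by apply/eqP; rewrite -oppr_eq0 -gapN E.
Qed.

Lemma hyp_form i j s (u : 'cV[R]_n) (c : R) : i != j ->
  hyp R i j s = [set x | (x *m u) 0 0 = c] ->
  exists2 a, a != 0 & forall y, (y *m u) 0 0 - c = a * gap i j s y.
Proof.
move=> ij E; pose d : 'rV[R]_n := delta_mx 0 i; pose a := (d *m u) 0 0.
have gapd y t : gap i j s (y + t *: d) = gap i j s y + t.
  by rewrite /gap !mxE !eqxx [j == i]eq_sym (negbTE ij) /=; lra.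
have form y : (y *m u) 0 0 - c = a * gap i j s y.
  (* Sliding [y] along the [i]-th axis by minus its gap brings it onto the hyperplane, where the
     form takes the value [c]. *)
  have : hyp R i j s (y + (- gap i j s y) *: d) by apply/hypE; rewrite gapd subrr.
  rewrite E /= mulmxDl -scalemxAl !mxE mulNr => <-.
  by rewrite opprB addrC subrK mulrC /a !mxE.
exists a => //; apply/eqP => a0.
have allH y : hyp R i j s y.
  by rewrite E /=; apply/eqP; rewrite -subr_eq0 form a0 mul0r.
have := gapd 0 1; rewrite (hypE _ _ _ _).1 // (hypE _ _ _ _).1 // add0r => /esym/eqP.
by rewrite oner_eq0.
Qed.

Lemma hyp_linear_form i j s :
  hyp R i j s = [set x | (x *m (delta_mx i 0 - delta_mx j 0 : 'cV[R]_n)) 0 0 = s%:~R].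
Proof.
have form x : (x *m (delta_mx i 0 - delta_mx j 0 : 'cV_n)) 0 0 = x 0 i - x 0 j.
  by rewrite mulmxBr -!colE !mxE.
by apply/seteqP; split=> x; rewrite /hyp /= form.
Qed.

Lemma hyp_inj i j s i' j' s' : i != j -> i' != j' -> hyp R i j s = hyp R i' j' s' ->
  [/\ i = i', j = j' & s = s'] \/ [/\ i = j', j = i' & s = - s'].
Proof.
move=> ij ij'; rewrite (hyp_linear_form i' j' s') => /(hyp_form ij)[a a0 form].
have {}form y : gap i' j' s' y = a * gap i j s y.
  by rewrite -form mulmxBr -!colE !mxE.
have E0 : s'%:~R = a * s%:~R :> R.
  by have := form 0; rewrite /gap !mxE; lra.
have E k : (k == i')%:R - (k == j')%:R = a * ((k == i)%:R - (k == j)%:R).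
  have := form (delta_mx 0 k); rewrite /gap !mxE !eqxx /= E0.
  by rewrite ![_ == k]eq_sym; lra.
have inj (z z' : int) : z%:~R = z'%:~R :> R -> z = z' by move/intr_inj.
have Ei := E i; have Ej := E j.
move: Ei Ej; rewrite !eqxx [j == i]eq_sym (negbTE ij).
case: (eqVneq i i') => [ei|ni]; case: (eqVneq i j') => [ei'|ni'];
  case: (eqVneq j i') => [ej|nj]; case: (eqVneq j j') => [ej'|nj'] /=;
  subst; rewrite ?eqxx // in ij ij' *; rewrite ?subr0 ?sub0r ?mulr1 ?mulrN1 ?subrr => Ei Ej;
  try (exfalso; lra).
- by left; split=> //; apply: inj; rewrite E0 -Ei mul1r.
- by right; split=> //; apply: inj; rewrite mulrNz E0 -Ei; lra.
Qed.

(** Every equation of the hyperplane is a nonzero multiple of [gap], so the parts are the sign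
    classes of [gap], whichever equation was chosen. *)
Lemma hyp_part_sg i j s P x y : i != j -> hyp_part (hyp R i j s) P -> P x ->
  P y <-> Num.sg (gap i j s y) = Num.sg (gap i j s x).
Proof.
move=> ij [u [c [_ /(hyp_form ij)[a a0 form] HP]]] Px.
have sgf z : Num.sg ((z *m u) 0 0 - c) = Num.sg a * Num.sg (gap i j s z).
  by rewrite form sgrM.
have sa : Num.sg a != 0 by rewrite sgr_eq0.
suff H : P y <-> Num.sg ((y *m u) 0 0 - c) = Num.sg ((x *m u) 0 0 - c).
  by rewrite H !sgf; split=> [/(mulfI sa)//|->].
have sgP : [\/ exists2 e : R, e = -1 & P = [set z | Num.sg ((z *m u) 0 0 - c) = e],
    exists2 e : R, e = 0 & P = [set z | Num.sg ((z *m u) 0 0 - c) = e]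
   |exists2 e : R, e = 1 & P = [set z | Num.sg ((z *m u) 0 0 - c) = e]].
  case: HP => ->; [constructor 1; exists (-1)|constructor 2; exists 0|constructor 3; exists 1] => //;
    apply/seteqP; split=> z /=.
  - by rewrite -subr_lt0 => /ltr0_sg.
  - by move/eqP; rewrite sgr_cp0 subr_lt0.
  - by move=> ->; rewrite subrr sgr0.
  - by move/eqP; rewrite sgr_cp0 subr_eq0 => /eqP.
  - by rewrite -subr_gt0 => /gtr0_sg.
  - by move/eqP; rewrite sgr_cp0 subr_gt0.
by case: sgP => -[e _ EP]; move: Px; rewrite EP /= => ->.
Qed.

Lemma hyp_part_ex i j s x : i != j -> exists2 P, hyp_part (hyp R i j s) P & P x.
Proof.
move=> ij; pose u : 'cV[R]_n := delta_mx i 0 - delta_mx j 0.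
have u0 : u != 0.
  apply/eqP => /matrixP/(_ i 0); rewrite !mxE !eqxx (negbTE ij) /= subr0 => /eqP.
  by rewrite oner_eq0.
case: (ltgtP ((x *m u) 0 0) s%:~R) => H.
- exists [set z | (z *m u) 0 0 < s%:~R] => //.
  by exists u, s%:~R; split; [|exact: hyp_linear_form|constructor 1].
- exists [set z | s%:~R < (z *m u) 0 0] => //.
  by exists u, s%:~R; split; [|exact: hyp_linear_form|constructor 3].
- exists [set z | (z *m u) 0 0 = s%:~R] => //.
  by exists u, s%:~R; split; [|exact: hyp_linear_form|constructor 2].
Qed.

Definition cell (A : arrangement R n) x : set 'rV[R]_n :=
  [set y | forall i j s, i != j -> A (hyp R i j s) ->
     Num.sg (gap i j s y) = Num.sg (gap i j s x)].

Variable A : arrangement R n.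
Hypothesis HA : forall H, A H -> exists i j s, i != j /\ H = hyp R i j s.

Lemma face_cell F x : faces A F -> F x -> F = cell A x.
Proof.
move=> [_ [ch [Hch ->]]] Fx; apply/seteqP; split=> y Hy.
  move=> i j s ij AH; apply/(hyp_part_sg y ij (Hch _ AH)); first exact: Fx.
  exact: Hy.
move=> H AH; have [i [j [s [ij E]]]] := HA AH; have := Hch _ AH.
rewrite {1}E => Hp; apply/(hyp_part_sg y ij Hp); first exact: Fx.
by apply: Hy => //; rewrite -E.
Qed.

Lemma cell_face x : faces A (cell A x).
Proof.
split; first by exists x.
have ex H : exists P, A H -> hyp_part H P /\ P x.
  (* The choice function must be total; outside [A] its value is the whole space. *)
  case: (pselect (A H)) => AH; last by exists setT.
  have [i [j [s [ij E]]]] := HA AH; case: (hyp_part_ex s x ij) => P HP Px.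
  by exists P; rewrite E.
have [ch Hch] := choice ex.
exists ch; split=> [H /Hch[]//|]; apply/seteqP; split=> y Hy.
  move=> H AH; have [i [j [s [ij E]]]] := HA AH; have [Hp Px] := Hch _ AH.
  rewrite {1}E in Hp; apply/(hyp_part_sg y ij Hp Px).
  by apply: Hy => //; rewrite -E.
move=> i j s ij AH; have [Hp Px] := Hch _ AH.
exact/(hyp_part_sg y ij Hp Px)/Hy.
Qed.

End Hyperplanes.

(** * The ideal arrangement and the equality of the two sets of trees *)

Section IdealArrangement.
Import Order.TTheory GRing.Theory Num.Theory.
Local Open Scope ring_scope.
Variables (R : realType) (m n : nat) (hm : (0 < m)%N).
Variables (I : {set 'I_n * 'I_n}) (hI : is_ideal I).
Local Notation A := (ideal_arr R m I).

Lemma ideal_arr_hyp H : A H -> exists i j s, i != j /\ H = hyp R i j s.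
Proof.
case=> [[i [j [s [ij _ ->]]]]|[i [j [ij ->]]]].
  by exists i, j, s; split=> //; rewrite -val_eqE /=; lia.
by exists i, j, m%:Z; split=> //; apply: hI.1.
Qed.

Lemma ideal_arrP i j (s : int) : i != j -> A (hyp R i j s) <->
  [\/ - m%:Z < s < m%:Z, s = m%:Z /\ (i, j) \in I | s = - m%:Z /\ (j, i) \in I].
Proof.
move=> ij; split.
  case=> [[i' [j' [t [ij' ht]]]]|[i' [j' [Iij]]]].
    case/hyp_inj => // [|[_ _ ->]|[_ _ ->]]; [by rewrite -val_eqE /=; lia|..];
      by constructor 1; lia.
  case/hyp_inj => // [|[-> -> ->]|[-> -> ->]]; first exact: hI.1.
    by constructor 2.
  by constructor 3.
case=> [hs|[-> Iij]|[-> Iij]].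
- left; case: (ltngtP i j) => h; last by rewrite (val_inj h) eqxx in ij.
    by exists i, j, s; split=> //; lia.
  by exists j, i, (- s); split=> //; [lia|exact: hyp_swap].
- by right; exists i, j.
- by right; exists j, i; split=> //; rewrite hyp_swap opprK.
Qed.

Lemma ideal_arr_nat i j (s : nat) : (s <= m)%N -> i != j ->
  A (hyp R i j s%:Z) <-> (s < m)%N \/ (i, j) \in I.
Proof.
move=> sm ij; rewrite ideal_arrP //; split=> [[h|[_ h]|[h _]]|[h|h]].
- by left; lia.
- by right.
- by left; lia.
- by constructor 1; lia.
- case: (ltngtP s m) sm => // [h'|->] _; first by constructor 1; lia.
  by constructor 2.
Qed.

Lemma ideal_down (i j i' j' : 'I_n) : (i', j') \in I -> i != j ->
  (i <= i')%N -> (j' <= j)%N -> (i, j) \in I.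
Proof. by move=> h ij hi hj; apply: hI.2 h ij hi hj. Qed.

Section MarkedTree.
Variable M : markedtree m n.
Hypothesis HM : marked_trees M.
Local Notation T := M.1.
Let mn : is_mn_tree T := marked_mn HM.

Lemma child_neq i s j : is_child T i s j -> i != j.
Proof.
move/(is_childP mn) => E; apply/eqP => ij; rewrite ij in E.
exact: rcons_neq (esym E).
Qed.

Lemma drift_hyp_child i s j : is_child T i s j -> drift_hyp T i j = hyp R i j (s : nat)%:Z.
Proof. by move=> /(drift_child mn) E; rewrite /drift_hyp E; congr hyp; lia. Qed.

Lemma drift_hypC i j : drift_hyp T i j = drift_hyp T j i :> set 'rV[R]_n.
Proof. by rewrite /drift_hyp hyp_swap; congr hyp; lia. Qed.

Lemma ideal_child : (forall i j, is_child T i ord_max j -> (i, j) \in I) ->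
  forall i s j, is_child T i s j -> A (hyp R i j (s : nat)%:Z).
Proof.
move=> H i s j ch; have sm : (s <= m)%N by rewrite -ltnS.
apply/ideal_arr_nat => //; first exact: child_neq ch.
case: (ltngtP s m) sm => // [|sm] _; first by left.
by right; apply: H; rewrite (_ : ord_max = s) //; apply: val_inj.
Qed.

(** Each marked edge is already an edge of the graph on its block, by [ideal_child], and a block is
    a chain of marked edges. *)
Lemma ideal_arr_connected :
  (forall i j, is_child T i ord_max j -> (i, j) \in I) -> arr_connected A M.
Proof.
move=> H i j; pose e := (fun a b => `[< block_edge A M a b >]).
have esym a b : e a b = e b a.
  suff imp c d : e c d -> e d c by apply/idP/idP; apply: imp.
  move/asboolP=> [cd B Acd]; apply/asboolP; split; first by rewrite eq_sym.
    exact: same_block_sym.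
  by rewrite drift_hypC.
have Hc a b : connect (mchild M) a b -> connect e a b.
  move: a b; apply: mchain_ind => [a|a c b ac _ IH]; first exact: connect0.
  apply: connect_trans IH; apply: connect1; apply/asboolP.
  case/(mchildP HM): (ac) => s [/cadet_child ch _]; split.
  - by rewrite eq_sym (child_neq ch).
  - by apply/same_blockP => //; rewrite connect1.
  - by rewrite drift_hypC (drift_hyp_child ch); apply: ideal_child.
move/(same_blockP HM) => /orP[/Hc//|/Hc ji].
by rewrite (sym_connect_sym esym).
Qed.

Lemma ideal_cadet_condition :
  (forall i j, is_child T i ord_max j -> (i, j) \in I) -> cadet_condition A M.
Proof.
move=> H i j s /cadet_child ch _; right; exists i, j; split; try by left.
by rewrite (drift_hyp_child ch); apply: ideal_child.
Qed.

(* Within a chain of 0-cadets marked labels increase downwards, so the ideal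
   property transports a hyperplane between the two parts to the pair (i, j). *)
Lemma ideal_across i j i' j' : is_child T i ord_max j ->
  connect (mchild M) i i' -> connect (mchild M) j' j ->
  A (drift_hyp T i' j') -> (i, j) \in I.
Proof.
move=> ch ii' jj'; have Ei : drift T i = (drift T j + m)%N by apply: (drift_child mn ch).
have li := mchain_drift_le HM ii'; have lj := mchain_drift_le HM jj'.
have ij' : i' != j' by apply/eqP => E; rewrite E in li; lia.
move/(ideal_arrP _ ij') => [|[E Iij]|[]]; [lia| |lia].
apply: ideal_down Iij (child_neq ch) _ _; apply: (mchain_label HM) => //; lia.
Qed.

(** A node has at most one marked child, so two chains leaving [a] coincide until one of them
    ends. *)
Lemma mchain_linear a b c : connect (mchild M) a b -> connect (mchild M) a c ->
  connect (mchild M) b c \/ connect (mchild M) c b.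
Proof.
move=> ab; move: a b ab c; apply: mchain_ind => [a c|a d b ad db IH c ac]; first by left.
case: (eqVneq a c) => [<-|ne]; first by right; apply: connect_trans (connect1 ad) db.
have [d' ad' d'c] := mchain_first ac ne.
by apply: IH; rewrite (mchild_child HM ad ad').
Qed.

Lemma connect_cross (e : rel 'I_n) (U : pred 'I_n) a b :
  connect e a b -> U a -> ~~ U b -> exists c d, [/\ e c d, U c & ~~ U d].
Proof.
move=> /connectP[q Hq ->] {b}; elim: q a Hq => [|c q IH] a /=; first by move=> _ ->.
case/andP=> ac Hq Ua Ub; case: (boolP (U c)) => Uc; first exact: IH Hq Uc Ub.
by exists a, c.
Qed.

Lemma arr_tree_ideal : arr_connected A M -> cadet_condition A M ->
  forall i j, is_child T i ord_max j -> (i, j) \in I.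
Proof.
move=> conn cad i j ch.
(* No child index exceeds [m], so an [m]-child is always a cadet. *)
have cd : is_cadet T i ord_max j.
  by rewrite /is_cadet ch; apply/forallP => t; apply/implyP; rewrite ltnNge -ltnS ltn_ord.
(* If the edge is marked, cut the block between [j] and [i]: connectedness gives a hyperplane across
   the cut, and [ideal_across] applies. *)
case: (boolP (edge i j \in M.2)) => e.
  have ji : mchild M j i by apply/mchildP => //; exists ord_max.
  have ij' : ~~ connect (mchild M) i j.
    apply/negP => h; have := mchain_anti HM h (connect1 ji).
    by move/eqP; rewrite (negbTE (child_neq ch)).
  have B : same_block M j i by apply/same_blockP => //; rewrite connect1.
  have [|a [b [/asboolP[ab Bab Aab] Ua Ub]]] :=
    connect_cross (U := fun k => connect (mchild M) k j) (conn _ _ B) _ ij'; first exact: connect0.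
  have {Bab} cab : connect (mchild M) a b.
    case/(same_blockP HM)/orP: Bab => // ba.
    by move: Ub; rewrite (connect_trans ba Ua).
  case: (mchain_linear Ua cab) => [jb|bj]; last by rewrite bj in Ub.
  have [|k jk kb] := mchain_first jb; first by apply: contraNneq Ub => ->.
  rewrite -(mchild_child HM ji jk) in kb.
  by apply: ideal_across ch kb Ua _; rewrite drift_hypC.
(* If the edge is unmarked, the cadet condition gives the hyperplane; its first alternative would
   need [m = 0]. *)
case: (cad _ _ _ cd e) => [[/(congr1 val) /= m0]|[i' [j' [Bi Bj Aij]]]].
  by move: hm; rewrite m0.
apply: (ideal_across ch _ _ Aij).
(* [i] is the top of its block: a marked parent would be [j], across the unmarked edge. *)
- case/(same_blockP HM)/orP: Bi => // ii'; case: (eqVneq i' i) => [->//|ne].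
  have [k ki _] := mchain_last ii' ne; case/negP: e.
  have [s Es] := mchild_word HM ki; move/(is_childP mn): ch; rewrite Es.
  by move=> /rcons_inj[/(node_vertex_inj mn)<- _]; case/andP: ki.
(* [j] is the bottom of its block: a marked child would be its cadet, which is the [m]-child [i]. *)
- case/(same_blockP HM)/orP: Bj => // jj'; case: (eqVneq j j') => [->//|ne].
  have [k jk _] := mchain_first jj' ne; case/negP: e.
  case/(mchildP HM): jk => s [/(is_cadetP mn)[Es L] e].
  move/(is_childP mn): (ch) => Ei; case: (ltngtP s m) => sm.
  + by case: (L ord_max i).
  + by have := ltn_ord s; rewrite ltnS leqNgt sm.
  + suff -> : i = k by [].
    apply: (node_vertex_inj mn); rewrite Ei Es; congr rcons; exact: val_inj.
Qed.

End MarkedTree.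

Lemma ideal_trees_arr_trees : ideal_trees m I = arr_trees m A.
Proof.
apply/seteqP; split=> M.
  by case=> HM H; split; [|exact: ideal_arr_connected|exact: ideal_cadet_condition].
by case=> HM c1 c2; split=> //; apply: arr_tree_ideal.
Qed.

End IdealArrangement.

(** * Points in the image of a tree *)

Section Points.
Import Order.TTheory GRing.Theory Num.Theory.
Local Open Scope ring_scope.
Variables (R : realType) (n : nat).
Implicit Types (i j k : 'I_n) (s : nat) (x y : 'rV[R]_n).

(* The value [x_j + s] precedes [x_i] once ties are broken as in the trees. *)
Definition below x j s i :=
  (x 0 j + s%:R < x 0 i) || (x 0 j + s%:R == x 0 i) && ((0 < s) || (j < i))%N.

Lemma below0 x j i :
  below x j 0 i = (x 0 j < x 0 i) || (x 0 j == x 0 i) && (j < i)%N.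
Proof. by rewrite /below addr0. Qed.

Lemma below0_irr x i : below x i 0 i = false.
Proof. by rewrite below0 ltxx ltnn andbF. Qed.

Lemma below0_trans x i j k : below x i 0 j -> below x j 0 k -> below x i 0 k.
Proof.
rewrite !below0 => /orP[ij|/andP[/eqP-> ij]] /orP[jk|/andP[/eqP E jk]].
- by rewrite (lt_trans ij jk).
- by rewrite -E ij.
- by rewrite jk.
- by rewrite E eqxx (ltn_trans ij jk) orbT.
Qed.

Lemma below0N x i j : i != j -> below x j 0 i = ~~ below x i 0 j.
Proof.
by rewrite !below0 -val_eqE; case: (ltgtP (x 0 i) (x 0 j)) => //= _; case: ltngtP.
Qed.

Lemma below_le x j s i : below x j s i -> x 0 j + s%:R <= x 0 i.
Proof. by case/orP=> [/ltW//|/andP[/eqP-> _]]. Qed.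

Lemma below_weak x j s i : below x j s i -> below x j 0 i.
Proof.
case: s => // s H; rewrite below0; apply/orP; left.
by apply: lt_le_trans (below_le H); rewrite ltrDl ltr0n.
Qed.

(** The place of [i] in the order by [(x_i, i)], and the measure for inductions along it. *)
Definition rank x i := #|[set j | below x j 0 i]|.

Lemma rank_lt x j i : below x j 0 i -> (rank x j < rank x i)%N.
Proof.
move=> ji; apply: proper_card; apply/properP; split.
  by apply/fintype.subsetP => k; rewrite !inE => kj; apply: below0_trans kj ji.
by exists j; rewrite !inE // below0_irr.
Qed.

End Points.

(** * Points of an image: the tree and the face they determine *)

Section PhiTheory.
Import Order.TTheory GRing.Theory Num.Theory.
Local Open Scope ring_scope.
Variables (R : realType) (m n : nat) (hm : (0 < m)%N).
Variables (I : {set 'I_n * 'I_n}) (hI : is_ideal I).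
Local Notation A := (ideal_arr R m I).
Implicit Types (i j k : 'I_n) (s t : 'I_m.+1) (M : markedtree m n) (x y : 'rV[R]_n).

Definition adm i j (s : nat) := (s < m)%N || ((i, j) \in I).

Lemma admP i j s : i != j -> A (hyp R i j (s : nat)%:Z) <-> adm i j s.
Proof.
move=> ij; have sm : (s <= m)%N by rewrite -ltnS.
by rewrite (ideal_arr_nat R hm hI) //; split=> /orP.
Qed.

Lemma TrP i j s : Tr A (i, j, s) <-> [/\ i != j, (0 < s)%N || (j < i)%N & adm i j s].
Proof. by split=> -[ij h h']; split=> //; apply/(admP s ij). Qed.

Section OneTree.
Variable M : markedtree m n.
Hypothesis HM : ideal_trees m I M.
Local Notation T := M.1.
Local Notation p := (node_vertex M.1).
Let HMm : marked_trees M := HM.1.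
Let mn : is_mn_tree T := marked_mn HMm.

Lemma child_adm i s j : is_child T i s j -> adm i j s.
Proof.
move=> ch; apply/(admP s (child_neq HMm ch)).
exact: (ideal_child R hm hI HMm HM.2 ch).
Qed.

Lemma mchain_prefix j i : connect (mchild M) j i -> i != j ->
  exists2 w, w <> [::] & p i = p j ++ w.
Proof.
move=> /(mchain_word HMm)[w E] ij; exists w => // w0.
by move: E; rewrite w0 cats0 => /(node_vertex_inj mn) E; rewrite E eqxx in ij.
Qed.

Lemma Phi_sign x i j s : Phi A M x -> ~ same_block M i j -> Tr A (i, j, s) ->
  if vle (rcons (p j) s) (p i) then (s : nat)%:R < x 0 i - x 0 j
  else x 0 i - x 0 j < (s : nat)%:R.
Proof.
move=> [_ H1 H2] B Hs; case: ifPn => H; first by apply: H2 Hs B _; apply/vpreceqP.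
by apply: H1 Hs B _; apply/vprecP.
Qed.

Lemma Phi_block_value x i j : Phi A M x -> connect (mchild M) j i ->
  x 0 i - x 0 j = (drift T i)%:R - (drift T j)%:R.
Proof. by move=> [H _ _]; apply: (mchain_value HMm). Qed.

(** Between different blocks [Phi] prescribes this very comparison. Inside a block the differences
    of [x] are differences of drifts, and labels increasing along marked 0-cadets settle the
    ties. *)
Lemma Phi_order_pos x i j s : Phi A M x -> i != j -> adm i j s ->
  (0 < s)%N || (j < i)%N -> vle (rcons (p j) s) (p i) = below x j s i.
Proof.
move=> Px ij As s0; rewrite /below s0 andbT orbC -le_eqVlt.
case: (pselect (same_block M i j)) => B; last first.
  have Hs : Tr A (i, j, s) by apply/TrP.
  by have := Phi_sign Px B Hs; case: ifP => _ h; apply/esym/idP; lra.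
have eq_le (a b : R) : (b <= a) = (0 <= a - b) by rewrite subr_ge0.
rewrite eq_le opprD addrA; case/(same_blockP HMm)/orP: B => B.
  have [|w w0 E] := mchain_prefix B; first by rewrite eq_sym.
  have -> : vle (rcons (p j) s) (p i) = false.
    apply/negP => h; have ji := vle_trans (vle_rcons (p j) s) h.
    have iw : vle (p i) (p j) by rewrite E vle_catr.
    by move: ij; rewrite (node_vertex_inj mn (vle_anti iw ji)) eqxx.
  apply/esym/negP => h; have Ev := Phi_block_value Px B.
  have : (drift T i)%:R - (drift T j)%:R - s%:R >= 0 :> R by lra.
  rewrite -addrA -opprD subr_ge0 -natrD ler_nat => h'.
  have dij : drift T j = drift T i by have := mchain_drift_le HMm B; lia.
  by have := mchain_label HMm B dij; lia.
have [w w0 E] := mchain_prefix B ij.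
rewrite (Phi_block_value Px B) E vle_rcons_cat // /drift E vdrift_cat natrD.
rewrite [X in 0 <= X - _](_ : _ = (vdrift w)%:R) ?subr_ge0 ?ler_nat //.
by rewrite addrAC subrr add0r.
Qed.

(** The new case [s = 0], [i < j] is no triple of [Tr]. The triple [(j, i, 0)] decides it, since a
    0-child immediately follows its parent. *)
Lemma Phi_order x i j s : Phi A M x -> i != j -> adm i j s ->
  vle (rcons (p j) s) (p i) = below x j s i.
Proof.
move=> Px ij As; case: (boolP ((0 < s)%N || (j < i)%N)) => [|H]; first exact: Phi_order_pos.
have s0 : s = ord0 by apply: val_inj => /=; lia.
have ji : (i < j)%N by move: H ij; rewrite negb_or -val_eqE /=; lia.
have adm0 a b : adm a b (@ord0 m) by rewrite /adm hm.
rewrite s0 [RHS]below0N // -(Phi_order_pos (s := ord0)) ?ji ?orbT 1?eq_sym //.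
have pij : p i <> p j by move/(node_vertex_inj mn)/eqP; rewrite (negbTE ij).
apply/idP/negP => [h1 h2|h].
  have := vle_trans (vle_rcons (p j) ord0) (vle_trans h1 (vle_trans (vle_rcons (p i) ord0) h2)).
  have := vle_anti (vle_trans (vle_rcons (p j) ord0) h1) (vle_trans (vle_rcons (p i) ord0) h2).
  by move/esym.
apply: vle_rcons0; first exact/nesym.
apply: vleNge; apply/negP => h'; apply: h; exact: vle_rcons0.
Qed.

(** An unmarked edge joins different blocks, so [Phi] imposes a strict inequality on it, through
    [(i, j, s)] or, when [s = 0] and [i < j], through [(j, i, 0)]. *)
Lemma Phi_mark x i j s : Phi A M x -> is_child T i s j ->
  edge i j \in M.2 <-> x 0 i - x 0 j = (s : nat)%:R.
Proof.
move=> Px ch; split=> [e|E]; first by case: Px => H _ _; apply: H e ch.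
apply: (mark_block HMm _ ch); apply: contrapT => B.
have ij := child_neq HMm ch.
have sx : x 0 j + (s : nat)%:R = x 0 i by rewrite -E addrC subrK.
case: (boolP ((0 < s)%N || (j < i)%N)) => [s0|H].
  have /(Phi_sign Px B) : Tr A (i, j, s) by apply/TrP; split=> //; apply: child_adm.
  by rewrite E ltxx; case: ifP.
have s0 : s = ord0 by apply: val_inj => /=; lia.
have ji : (i < j)%N by move: H ij; rewrite negb_or -val_eqE /=; lia.
have /(Phi_sign Px (fun h => B (same_block_sym HMm h))) : Tr A (j, i, ord0 : 'I_m.+1).
  by apply/TrP; rewrite eq_sym ij /= ji /adm hm.
have -> : x 0 j - x 0 i = 0 by rewrite -sx s0 addr0 subrr.
by rewrite ltxx; case: ifP.
Qed.

Lemma Phi_sg x y i j s : Phi A M x -> Phi A M y -> i != j -> adm i j s ->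
  (0 < s)%N || (j < i)%N ->
  Num.sg (gap i j (s : nat)%:Z y) = Num.sg (gap i j (s : nat)%:Z x).
Proof.
move=> Px Py ij As s0; rewrite /gap -!pmulrn.
case: (pselect (same_block M i j)) => B.
  suff -> : x 0 i - x 0 j = y 0 i - y 0 j by [].
  case/(same_blockP HMm)/orP: B => B; last by rewrite !Phi_block_value.
  by rewrite -opprB (Phi_block_value Px B) -(Phi_block_value Py B) opprB.
have Hs : Tr A (i, j, s) by apply/TrP.
have := Phi_sign Px B Hs; have := Phi_sign Py B Hs; case: ifP => _ h1 h2.
  by rewrite !gtr0_sg // subr_gt0.
by rewrite !ltr0_sg // subr_lt0.
Qed.

(** Each hyperplane of [A] has an equation given by a triple of [Tr], whose sign is constant on the
    image; conversely every condition in [Phi] is a sign on a hyperplane of [A]. *)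
Lemma Phi_cell x : Phi A M x -> Phi A M = cell A x.
Proof.
move=> Px; apply/seteqP; split=> y Hy.
  have pos i j (s : int) : i != j -> A (hyp R i j s) ->
      (0 < s) || (s == 0) && (j < i)%N -> Num.sg (gap i j s y) = Num.sg (gap i j s x).
    move=> ij As s0; have sm : (`|s| < m.+1)%N.
      by move/(ideal_arrP R hm hI s ij): (As) => [|[]|[]] *; lia.
    have Es : s = (Ordinal sm : nat)%:Z by rewrite /=; case/orP: s0; lia.
    rewrite Es; apply: Phi_sg => //; first by apply/admP; rewrite // -Es.
    by rewrite /=; case/orP: s0 => ?; apply/orP; [left|right]; lia.
  move=> i j s ij As; case: (boolP ((0 < s) || (s == 0) && (j < i)%N)) => [|H].
    exact: pos.
  have : Num.sg (gap j i (- s) y) = Num.sg (gap j i (- s) x).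
    apply: pos; [by rewrite eq_sym|by rewrite -hyp_swap|].
    by move: H ij; rewrite -val_eqE /=; lia.
  by rewrite !gapN !sgrN => /oppr_inj.
case: (Px) => H1 H2 H3; split=> [i j s e ch|i j s Hs B o|i j s Hs B o].
- have := Hy i j (s : nat)%:Z (child_neq HMm ch) (ideal_child R hm hI HMm HM.2 ch).
  rewrite /gap -!pmulrn (H1 _ _ _ e ch) subrr sgr0 => /eqP.
  by rewrite sgr_eq0 subr_eq0 => /eqP.
- case: (Hs) => ij _ As; have := Hy i j _ ij As.
  rewrite /gap -!pmulrn (ltr0_sg (x := x 0 i - x 0 j - _)) ?subr_lt0; last exact: H2.
  by move/eqP; rewrite sgr_cp0 subr_lt0.
- case: (Hs) => ij _ As; have := Hy i j _ ij As.
  rewrite /gap -!pmulrn (gtr0_sg (x := x 0 i - x 0 j - _)) ?subr_gt0; last exact: H3.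
  by move/eqP; rewrite sgr_cp0 subr_gt0.
Qed.

End OneTree.

Lemma child_below x M i j s : ideal_trees m I M -> Phi A M x ->
  node_vertex M.1 i = rcons (node_vertex M.1 j) s -> below x j s i.
Proof.
move=> HM Px E; have ch : is_child M.1 i s j by apply/(is_childP (marked_mn HM.1)).
rewrite -(Phi_order HM Px) ?E ?vle_refl //; first exact: (child_neq HM.1 ch).
exact: child_adm ch.
Qed.

Lemma root_first x M i j : ideal_trees m I M -> Phi A M x ->
  node_vertex M.1 i = [::] -> ~~ below x j 0 i.
Proof.
move=> HM Px E; case: (eqVneq i j) => [->|ij]; first by rewrite below0_irr.
rewrite -(Phi_order (s := ord0) HM Px ij); last by rewrite /adm hm.
by rewrite E; apply/negP => /vle_anti/(_ (vle_nil _)); case: (node_vertex _ j).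
Qed.

(* Were the first node with two different positions [v <> v'] in the trees,
   say with [v] preceding [v'], then [x] would put it before [v'] by the first
   tree, and not before [v'] by the second. *)
Lemma Phi_uniq_vertex M M' x i :
  ideal_trees m I M -> ideal_trees m I M' -> Phi A M x -> Phi A M' x ->
  node_vertex M.1 i = node_vertex M'.1 i.
Proof.
move=> HM HM' Px Px'; have [k] := ubnP (rank x i); elim: k i => // k IH i.
rewrite ltnS => ri; have mn := marked_mn HM.1; have mn' := marked_mn HM'.1.
case: (node_vertex_parent mn i) => [E|[j [s E]]];
  case: (node_vertex_parent mn' i) => [E'|[j' [s' E']]].
- by rewrite E E'.
- have := below_weak (child_below HM' Px' E').
  by rewrite (negbTE (root_first _ HM Px E)).
- have := below_weak (child_below HM Px E).
  by rewrite (negbTE (root_first _ HM' Px' E')).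
have b := child_below HM Px E; have b' := child_below HM' Px' E'.
have Ej : node_vertex M.1 j = node_vertex M'.1 j.
  by apply: IH; apply: leq_trans ri; apply: rank_lt (below_weak b).
have Ej' : node_vertex M.1 j' = node_vertex M'.1 j'.
  by apply: IH; apply: leq_trans ri; apply: rank_lt (below_weak b').
have ch : is_child M.1 i s j by apply/(is_childP mn).
have ch' : is_child M'.1 i s' j' by apply/(is_childP mn').
case/orP: (vle_total (node_vertex M.1 i) (node_vertex M'.1 i)) => h; apply: vle_anti => //.
  rewrite E' -Ej' (Phi_order HM Px) //; first exact: (child_neq HM'.1 ch').
  exact: child_adm ch'.
rewrite E Ej (Phi_order HM' Px') //; first exact: (child_neq HM.1 ch).
exact: child_adm ch.
Qed.

(** The words of the nodes determine the tree, and by [Phi_mark] the marks are the edges whose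
    hyperplane contains [x]. *)
Lemma Phi_uniq M M' x :
  ideal_trees m I M -> ideal_trees m I M' -> Phi A M x -> Phi A M' x -> M = M'.
Proof.
move=> HM HM' Px Px'.
have ET : M.1 = M'.1.
  apply: node_vertex_ext (marked_mn HM.1) (marked_mn HM'.1) _ => i.
  exact: Phi_uniq_vertex Px Px'.
have sub N N' e : ideal_trees m I N -> ideal_trees m I N' -> Phi A N x -> Phi A N' x ->
    N.1 = N'.1 -> e \in N.2 -> e \in N'.2.
  move=> HN HN' PN PN' EN; case: HN (HN) => -[_ cad _] _ HN eN.
  have [i [j [s [/cadet_child ch E]]]] := cad e eN; rewrite E in eN *.
  apply/(Phi_mark HN' PN' (s := s)); first by rewrite -EN.
  exact/(Phi_mark HN PN ch).
apply: injective_projections => //; apply/setP => e; apply/idP/idP; exact: sub.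
Qed.

End PhiTheory.

(** * The tree of a point *)

Section Existence.
Import Order.TTheory GRing.Theory Num.Theory.
Local Open Scope ring_scope.
Variables (R : realType) (m n : nat) (hm : (0 < m)%N).
Variables (I : {set 'I_n * 'I_n}) (hI : is_ideal I).
Variable x : 'rV[R]_n.
Local Notation A := (ideal_arr R m I).
Implicit Types (i j k : 'I_n) (s t : 'I_m.+1).

Lemma below_le_pos j (s : nat) i : (0 < s)%N -> below x j s i = (x 0 j + s%:R <= x 0 i).
Proof. by move=> s0; rewrite /below s0 andbT orbC le_eqVlt. Qed.

Lemma below_mono j i (s t : nat) : (s <= t)%N -> below x j t i -> below x j s i.
Proof.
rewrite leq_eqVlt => /orP[/eqP->//|st] /below_le h; apply/orP; left.
by apply: lt_le_trans h; rewrite ltrD2l ltr_nat.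
Qed.

Lemma below_add j k i (s t : nat) :
  below x j t k -> below x k s i -> below x j (t + s) i.
Proof.
move=> h1 h2; case: (posnP (t + s)) => [/eqP|ts].
  rewrite addn_eq0 => /andP[/eqP t0 /eqP s0]; rewrite t0 s0 in h1 h2 *.
  exact: below0_trans h1 h2.
rewrite below_le_pos // natrD addrA.
by have := below_le h1; have := below_le h2; lra.
Qed.

Definition cand i : pred ('I_n * 'I_m.+1) :=
  fun c => adm m I i c.1 c.2 && below x c.1 c.2 i.

(** [d] bounds a recursion along [rank]. The empty maximum is [[::]], so a node without candidates
    becomes the root. *)
Fixpoint position_rec (d : nat) i : vertex m :=
  if d is d'.+1 then
    \big[@vmax m/[::]]_(c | cand i c) rcons (position_rec d' c.1) c.2
  else [::].

Definition position i := position_rec (rank x i).+1 i.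
Local Notation q := position.

Lemma position_rec_stable d d' i : (rank x i < d)%N -> (rank x i < d')%N ->
  position_rec d i = position_rec d' i.
Proof.
elim: d d' i => [|d IH] [|d'] i //=; rewrite !ltnS => h h'.
apply: eq_bigr => -[j s] /andP[_ /below_weak/rank_lt ji] /=.
by rewrite (IH d') //; apply: leq_trans ji _.
Qed.

Lemma positionE i : q i = \big[@vmax m/[::]]_(c | cand i c) rcons (q c.1) c.2.
Proof.
rewrite {1}/position /=; apply: eq_bigr => -[j s] /andP[_ /below_weak/rank_lt ji] /=.
by rewrite (position_rec_stable (d' := (rank x j).+1)).
Qed.

Lemma position_ge i j s : adm m I i j s -> below x j s i -> vle (rcons (q j) s) (q i).
Proof.
move=> a b; rewrite [q i]positionE.
have := @vle_bigmax m _ (index_enum _) (cand i) (fun c => rcons (q c.1) c.2) (j, s).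
by apply; [exact: mem_index_enum|rewrite /cand /= a].
Qed.

Lemma position_ex i : q i = [::] \/
  exists j s, [/\ adm m I i j s, below x j s i & q i = rcons (q j) s].
Proof.
rewrite positionE; case: (bigmax_ex (index_enum _) (cand i) (fun c => rcons (q c.1) c.2)).
  by left.
by case=> -[j s] /andP[a b] ->; right; exists j, s.
Qed.

Lemma position_ge0 i j : below x j 0 i -> vle (rcons (q j) ord0) (q i).
Proof. by move=> h; apply: (position_ge (s := ord0)); rewrite ?/adm ?hm. Qed.

(** Otherwise [i] is read before [j], and [position_ge0] places [j] strictly after [i]. *)
Lemma position_below0 i j : i != j -> vle (q j) (q i) -> below x j 0 i.
Proof.
move=> ij h; rewrite below0N //; apply/negP => /position_ge0 h'.
by have := vle_trans h' h; rewrite (negbTE (vle_rconsN _ _)).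
Qed.

Lemma position_inj : injective q.
Proof.
move=> i j E; apply/eqP/negP => /negP ij.
have := position_below0 ij; rewrite E vle_refl => /(_ isT).
rewrite below0N // position_below0 //; first by rewrite eq_sym.
by rewrite E vle_refl.
Qed.

Lemma position_prefix i v w : q i = v ++ w -> exists j, q j = v.
Proof.
elim/last_ind: w i => [|w s IH] i; first by rewrite cats0; exists i.
rewrite -rcons_cat; case: (position_ex i) => [->|[j [t [_ _ ->]]]].
  by case: (v ++ w).
by case/rcons_inj => /IH.
Qed.

Lemma position_child i j s : q i = rcons (q j) s -> adm m I i j s /\ below x j s i.
Proof.
case: (position_ex i) => [->|[k [t [a b ->]]]]; first by case: (q j).
by case/rcons_inj => /position_inj <- <-.
Qed.

(** The converse of [position_ge]: shifting by the last letter [t] of [q i] reduces the comparison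
    with [i] to one with its parent [k], by induction on the rank. *)
Lemma position_below i j s : i != j -> vle (rcons (q j) s) (q i) -> below x j s i.
Proof.
have [d] := ubnP (rank x i); elim: d i s => // d IH i s; rewrite ltnS => ri ij h.
case: (posnP s) => [s0|s0].
  by rewrite s0; apply: position_below0 => //; apply: vle_trans (vle_rcons _ _) h.
case: (position_ex i) => [E|[k [t [a b E]]]].
  by move: h; rewrite E => /vle_anti/(_ (vle_nil _)); case: (q j).
rewrite E in h; case: (eqVneq j k) => [jk|jk].
  rewrite -jk in b h; apply: below_mono b.
  by case/orP: h => [|/andP[/eqP]]; rewrite !vdrift_rcons; lia.
have qjk : q j <> q k by move/position_inj/eqP; rewrite (negbTE jk).
case: (leqP t s) => ts.
  have lt_u : (s - t < m.+1)%N by apply: leq_ltn_trans (leq_subr _ _) (ltn_ord s).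
  have Eu : (Ordinal lt_u + t)%N = s by rewrite /= subnK.
  rewrite (vle_shift qjk Eu) in h; rewrite -Eu; apply: (below_add _ b).
  apply: IH h; last by rewrite eq_sym.
  by apply: leq_trans ri; apply: rank_lt (below_weak b).
(* Here [t > s], so the shift goes the other way, and [position_ge] is used contraposed, for [j]
   against the child position [t - s] of [k]. *)
have lt_u : (t - s < m.+1)%N by apply: leq_ltn_trans (leq_subr _ _) (ltn_ord t).
have Eu : (Ordinal lt_u + s)%N = t by rewrite /= subnK // ltnW.
have := vle_shiftN qjk Eu h; apply: contraNT => nb; apply: position_ge.
  by rewrite /adm; apply/orP; left; rewrite /=; have := ltn_ord t; lia.
have u0 : (0 < Ordinal lt_u)%N by rewrite /= subn_gt0.
rewrite below_le_pos // in nb; rewrite below_le_pos //.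
have Er : (t : nat)%:R = (Ordinal lt_u : nat)%:R + (s : nat)%:R :> R by rewrite -natrD Eu.
have := below_le b; rewrite Er; move: nb; rewrite -ltNge; lra.
Qed.

(* If [k] were the t-child of [j] with [t > s], it would lie at distance at
   least [t - s] after [i], hence be attached to [i] rather than to [j]. *)
Lemma position_cadet i j s t k : q i = rcons (q j) s ->
  x 0 i - x 0 j = (s : nat)%:R -> (s < t)%N -> q k <> rcons (q j) t.
Proof.
move=> Ei xij st Ek; have [ai bi] := position_child Ei; have [ak bk] := position_child Ek.
have lt_u : (t - s < m.+1)%N by apply: leq_ltn_trans (leq_subr _ _) (ltn_ord t).
have Eu : (Ordinal lt_u + s)%N = t by rewrite /= subnK // ltnW.
have ki : k != i.
  apply/eqP => E; move: Ek; rewrite E Ei => /rcons_inj[E'].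
  by move: st; rewrite E' ltnn.
have u0 : (0 < Ordinal lt_u)%N by rewrite /= subn_gt0.
have : vle (rcons (q i) (Ordinal lt_u)) (q k).
  apply: position_ge; last first.
    rewrite below_le_pos //.
    have Er : (t : nat)%:R = (Ordinal lt_u : nat)%:R + (s : nat)%:R :> R by rewrite -natrD Eu.
    by have := below_le bk; rewrite Er; lra.
  case/orP: ak => [tm|Ikj]; first by rewrite /adm /=; apply/orP; left; lia.
  (* Only [s = 0] can leave the index equal to [m]; then [x_i = x_j] forces [j < i], and the ideal
     property passes from [(k, j)] to [(k, i)]. *)
  rewrite /adm; case: (posnP s) => s0; last by apply/orP; left; have := ltn_ord t; rewrite /=; lia.
  apply/orP; right; apply: (ideal_down hI Ikj) => //.
  have e : x 0 j + (s : nat)%:R = x 0 i by lra.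
  by move: bi; rewrite /below e ltxx eqxx s0 /=; lia.
rewrite Ek Ei /vle !vdrift_rcons -addnA [(s + _)%N]addnC Eu ltnn eqxx /=.
by rewrite -!cats1 -catA lexle_cat2 /= -val_eqE /=; lia.
Qed.

Definition tight (T : tree m n) : {set {set 'I_n}} :=
  [set e | [exists i, exists j, exists s,
    [&& is_child T i s j, e == edge i j & x 0 i - x 0 j == (s : nat)%:R]]]%SET.

Lemma tightP T e : reflect
  (exists i j s, [/\ is_child T i s j, e = edge i j & x 0 i - x 0 j = (s : nat)%:R])
  (e \in tight T).
Proof.
rewrite inE; apply: (iffP existsP) => [[i /existsP[j /existsP[s /and3P[c /eqP e1 /eqP e2]]]]|].
  by exists i, j, s.
case=> i [j [s [c -> e2]]]; exists i; apply/existsP; exists j; apply/existsP; exists s.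
by rewrite c eqxx e2 eqxx.
Qed.

Lemma Phi_ex : exists2 M, ideal_trees m I M & Phi A M x.
Proof.
have [T [mn pq]] := build_tree position_inj position_prefix.
have chP i s j : is_child T i s j <-> q i = rcons (q j) s.
  by rewrite (is_childP mn) !pq.
pose M : markedtree m n := (T, tight T).
have HM : marked_trees M.
  split=> // [e /tightP[i [j [s [c -> xij]]]]|i j /cadet_child c /tightP[a [b [s [c' e xab]]]]].
    exists i, j, s; split=> //; apply/(is_cadetP mn); split; first exact/(is_childP mn).
    move=> t k st; rewrite !pq; apply: position_cadet xij st; exact/chP.
  case: (edge_eq e) => -[Ea Eb]; subst a b; last first.
    move/chP: c'; move/chP: c => -> /(congr1 size); rewrite !size_rcons; lia.
  move/chP: c => c; move/chP: c'; rewrite c => /rcons_inj[s0].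
  (* At index 0 the tie [x_i = x_j] is broken by the labels, which yields the marking rule. *)
  have [_] := position_child c; rewrite -s0 /= in xab.
  by rewrite below0 (subr0_eq xab) ltxx eqxx.
have HI : ideal_trees m I M.
  by split=> [//|i j /chP/position_child[/orP[|//]]]; rewrite ltnn.
have mark i s j : is_child T i s j -> x 0 i - x 0 j = (s : nat)%:R -> mchild M j i.
  move=> c e; apply/andP; split; first by apply/existsP; exists s.
  by apply/tightP; exists i, j, s.
(* Ties occur only inside blocks. The induction compares [j] with the parent [k] of [i], with the
   three cases of [position_below]. *)
have chain i j s : i != j -> adm m I i j s -> (0 < s)%N || (j < i)%N ->
    x 0 i = x 0 j + (s : nat)%:R -> connect (mchild M) j i.
  have [d] := ubnP (rank x i); elim: d i j s => // d IH i j s; rewrite ltnS => ri ij a s0 xi.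
  have := position_ge a; rewrite /below xi eqxx s0 orbT => /(_ isT) h.
  case: (position_ex i) => [E|[k [t [a' b E]]]].
    by move: h; rewrite E => /vle_anti/(_ (vle_nil _)); case: (q j).
  have ck : is_child T i t k by apply/chP.
  rewrite E in h; have bl := below_le b; case: (eqVneq j k) => [jk|jk].
    have st : s = t :> nat.
      apply/eqP; rewrite eqn_leq; apply/andP; split.
        by rewrite jk in h; case/orP: h => [|/andP[/eqP]]; rewrite !vdrift_rcons; lia.
      by rewrite -(ler_nat R); rewrite -jk xi in bl; lra.
    by apply: connect1; rewrite jk; apply: mark ck _; rewrite -jk xi -st; lra.
  have qjk : q j <> q k by move/position_inj/eqP; rewrite (negbTE jk).
  case: (leqP t s) => ts.
    have lt_u : (s - t < m.+1)%N by apply: leq_ltn_trans (leq_subr _ _) (ltn_ord s).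
    have Eu : (Ordinal lt_u + t)%N = s by rewrite /= subnK.
    rewrite (vle_shift qjk Eu) in h.
    have bu : below x j (Ordinal lt_u) k by apply: position_below h; rewrite eq_sym.
    have bul := below_le bu.
    have Es : (s : nat)%:R = (Ordinal lt_u : nat)%:R + (t : nat)%:R :> R by rewrite -natrD Eu.
    (* The lower bounds on [x_k - x_j] and [x_i - x_k] add up to [x_i - x_j], so both are
       equalities. *)
    have xk : x 0 k = x 0 j + (Ordinal lt_u : nat)%:R by lra.
    have xik : x 0 i = x 0 k + (t : nat)%:R by lra.
    apply: (connect_trans (y := k)); last first.
      by apply: connect1; apply: mark ck _; lra.
    apply: (IH _ _ (Ordinal lt_u)) => //; last 1 first.
    + by move: bu; rewrite /below -xk ltxx eqxx.
    + by apply: leq_trans ri; apply: rank_lt (below_weak b).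
    + by rewrite eq_sym.
    case/orP: a => [sm|Iij]; first by rewrite /adm /=; apply/orP; left; lia.
    case: (posnP t) => t0; last by rewrite /adm /=; apply/orP; left; have := ltn_ord s; lia.
    apply/orP; right; apply: (ideal_down hI Iij) => //; first by rewrite eq_sym.
    by move: b; rewrite /below t0 xik t0 addr0 ltxx eqxx /=; lia.
  (* An impossible case: [x_j] is at least [x_k + t - s], so [j] would come no earlier than that
     child position of [k], against [h]. *)
  have lt_u : (t - s < m.+1)%N by apply: leq_ltn_trans (leq_subr _ _) (ltn_ord t).
  have Eu : (Ordinal lt_u + s)%N = t by rewrite /= subnK // ltnW.
  have := vle_shiftN qjk Eu h; case/negP; apply: position_ge; last first.
    rewrite below_le_pos; last by rewrite /= subn_gt0.
    have Er : (t : nat)%:R = (Ordinal lt_u : nat)%:R + (s : nat)%:R :> R by rewrite -natrD Eu.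
    by move: bl; rewrite xi Er; lra.
  case: (posnP s) => s1; last by rewrite /adm /=; apply/orP; left; have := ltn_ord t; lia.
  case/orP: a' => [sm|Iik]; first by rewrite /adm /=; apply/orP; left; lia.
  apply/orP; right; apply: (ideal_down hI Iik) => //.
  by move: s0; rewrite s1 /=; lia.
exists M => //; split=> [i j s /tightP[a [b [t [c' e xab]]]] c|i j s|i j s].
- case: (edge_eq e) => -[Ea Eb]; subst a b; last by case: (not_both_child HM c' c).
  by rewrite xab; move/chP: c'; move/chP: c => -> /rcons_inj[->].
- move=> /(TrP R hm hI)[ij s0 a] _ /vprecP; rewrite /child_vertex !pq.
  move=> h; rewrite ltNge; apply: contra h => h; apply: position_ge => //.
  by rewrite /below s0 andbT orbC -le_eqVlt; lra.
- move=> /(TrP R hm hI)[ij s0 a] B /vpreceqP; rewrite /child_vertex !pq.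
  move/(position_below ij)/below_le => h; rewrite lt_neqAle; apply/andP; split; last lra.
  apply/eqP => E; apply: B; apply/(same_blockP HM)/orP; right.
  by apply: chain a s0 _ => //; lra.
Qed.

End Existence.

(** * Nonemptiness and codimension *)

Section Nonempty.
Import Order.TTheory GRing.Theory Num.Theory.
Local Open Scope ring_scope.
Variables (R : realType) (m n : nat) (hm : (0 < m)%N).
Variables (I : {set 'I_n * 'I_n}) (hI : is_ideal I).
Local Notation A := (ideal_arr R m I).
Variables (M : markedtree m n) (HM : marked_trees M).
Local Notation p := (node_vertex M.1).
Let mn : is_mn_tree M.1 := marked_mn HM.

Lemma mchain_lexle j i : connect (mchild M) j i -> lexle (p j) (p i).
Proof. by case/(mchain_word HM) => w ->; apply: lexle_catr. Qed.

Lemma linked_last j i : connect (mchild M) j i -> j != i -> linked M i.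
Proof. by move=> c ji; have [k ki _] := mchain_last c ji; apply/existsP; exists k. Qed.

(* Every block is counted through its top, the only unlinked node in it. *)
Definition block_rank i := #|[set k | lexle (p k) (p i) && ~~ linked M k]|.

(** The top of the block of [j] is counted for [j]. Were it counted for [i], then [i] would lie
    between it and [j], hence in the same block. *)
Lemma block_rank_lt i j : lexle (p i) (p j) -> ~ same_block M i j ->
  (block_rank i < block_rank j)%N.
Proof.
move=> ij B; apply: proper_card; apply/properP; split.
  apply/fintype.subsetP => k; rewrite !inE => /andP[ki ->]; rewrite andbT.
  exact: lexle_trans ki ij.
have [k Uk kj] := mchain_top HM j; exists k; rewrite inE Uk andbT; first exact: mchain_lexle.
apply/negP => ki; apply: B; apply/(same_blockP HM)/orP; left.
by case: (mchain_contiguous HM kj ki ij).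
Qed.

(** A node after [j] and up to [i] lies on the chain from [j], so it has a marked parent and is not
    counted. *)
Lemma block_rank_mchild j i : mchild M j i -> block_rank i = block_rank j.
Proof.
move=> ji; apply: eq_card => k; rewrite !inE; have c := connect1 ji.
case: (boolP (linked M k)) => [|Uk]; rewrite ?andbF ?andbT //.
apply/idP/idP => [ki|kj]; last exact: lexle_trans kj (mchain_lexle c).
case/orP: (lexle_total (p k) (p j)) => // jk.
have [jk' _] := mchain_contiguous HM c jk ki.
case: (eqVneq j k) => [->|ne]; first exact: lexle_refl.
by rewrite (linked_last jk' ne) in Uk.
Qed.

Lemma block_rank_le i : (block_rank i <= n)%N.
Proof. by rewrite -[leqRHS]card_ord max_card. Qed.

Lemma Phi_nonempty : exists x, Phi A M x.
Proof.
(* A perturbation constant on blocks, increasing between them, and below 1, so that it never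
   overturns a difference of integral drifts. *)
pose e i : R := (block_rank i)%:R / n.+1%:R.
have e_lt i j : (block_rank i < block_rank j)%N -> e i < e j.
  by move=> h; rewrite ltr_pM2r ?invr_gt0 ?ltr0n // ltr_nat.
have e0 i : 0 <= e i by rewrite divr_ge0 ?ler0n.
have e1 i : e i < 1 by rewrite ltr_pdivrMr ?ltr0n // mul1r ltr_nat ltnS block_rank_le.
exists (\row_i ((drift M.1 i)%:R + e i)).
split=> [i j s ed ch|i j s /(TrP R hm hI)[ij _ _] B|i j s /(TrP R hm hI)[ij _ _] B];
  rewrite !mxE.
- have ji : mchild M j i by apply/(mchildP HM); exists s; split=> //; apply: mark_cadet.
  have -> : e i = e j by rewrite /e (block_rank_mchild ji).
  by rewrite (drift_child mn ch) natrD; lra.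
- rewrite /child_vertex => -[ne /vpreceqP]; rewrite /vle vdrift_rcons -!/(drift _ _).
  case/orP=> [h|/andP[/eqP h L]].
    have : (drift M.1 i).+1%:R <= (drift M.1 j + s)%:R :> R by rewrite ler_nat.
    by rewrite -natr1 natrD; have := e0 j; have := e1 i; lra.
  (* At equal drifts the depth-first order decides, and the perturbation follows it. *)
  rewrite h natrD; have := e_lt _ _ (block_rank_lt (lexle_ofvle h ne L) B); lra.
- rewrite /child_vertex => /vpreceqP; rewrite /vle vdrift_rcons -!/(drift _ _).
  case/orP=> [h|/andP[/eqP h L]].
    have : (drift M.1 j + s).+1%:R <= (drift M.1 i)%:R :> R by rewrite ler_nat.
    by rewrite -natr1 natrD; have := e0 i; have := e1 j; lra.
  rewrite -h natrD; have := lexle_trans (lexle_rcons (p j) s) L.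
  by move/block_rank_lt => /(_ (fun b => B (same_block_sym HM b)))/e_lt; lra.
Qed.

Definition block_tops := [set i | ~~ linked M i]%SET.

Lemma card_marks : (#|M.2| + #|block_tops| = n)%N.
Proof.
(* Matches each linked node with the edge to its parent; the default [i] concerns only tops. *)
pose f i := edge i (odflt i [pick j | mchild M j i]).
have fE j i : mchild M j i -> f i = edge i j.
  rewrite /f => ji; case: pickP => [k ki|/(_ j)]; last by rewrite ji.
  by rewrite (mchild_parent HM ki ji).
have -> : M.2 = [set f i | i in ~: block_tops]%SET.
  apply/setP => e; apply/idP/imsetP => [ee|[i]].
    case: HM => _ /(_ _ ee)[i [j [s [c E]]]] _; rewrite E in ee *.
    have ji : mchild M j i by apply/(mchildP HM); exists s.
    exists i; last by rewrite (fE j).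
    by rewrite !inE negbK; apply/existsP; exists j.
  by rewrite !inE negbK => /existsP[j ji] ->; rewrite (fE _ _ ji); case/andP: ji.
rewrite card_in_imset; last first.
  move=> i k; rewrite !inE !negbK => /existsP[j ji] /existsP[l lk].
  rewrite (fE _ _ ji) (fE _ _ lk) => /edge_eq[[]//|[ik jk]]; subst.
  have := mchild_word HM ji; have := mchild_word HM lk => -[s ->] [t].
  by move/(congr1 size); rewrite !size_rcons; lia.
by rewrite addnC cardsC card_ord.
Qed.

(** For a top [r], the indicator vector of its block. *)
Definition block_vector r : 'rV[R]_n := \row_i (connect (mchild M) r i)%:R.

Definition block_vectors : #|block_tops|.-tuple 'rV[R]_n :=
  [tuple block_vector (enum_val k) | k < #|block_tops|].

Lemma top_uniq r r' i : r \in block_tops -> r' \in block_tops ->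
  connect (mchild M) r i -> connect (mchild M) r' i -> r = r'.
Proof.
rewrite !inE => Ur Ur' ri r'i; apply/eqP.
case/orP: (lexle_total (p r) (p r')) => h.
  have [c _] := mchain_contiguous HM ri h (mchain_lexle r'i).
  by apply: contraNT Ur' => ne; apply: linked_last c ne.
have [c _] := mchain_contiguous HM r'i h (mchain_lexle ri).
by apply: contraNT Ur => ne; apply: (linked_last c); rewrite eq_sym.
Qed.

Lemma block_vectors_nth (k : 'I_#|block_tops|) :
  block_vectors`_k = block_vector (enum_val k).
Proof. by rewrite -tnth_nth tnth_mktuple. Qed.

Lemma block_vectors_sum (a : 'I_#|block_tops| -> R) k i :
  connect (mchild M) (enum_val k) i ->
  (\sum_k a k *: block_vectors`_k) 0 i = a k.
Proof.
move=> c; rewrite summxE (bigD1 k) //= block_vectors_nth !mxE c mulr1 big1 ?addr0 // => l lk.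
rewrite block_vectors_nth !mxE; case: (boolP (connect _ _ _)) => [c'|]; last by rewrite mulr0.
case/eqP: lk; apply: enum_val_inj; apply: top_uniq c' c; exact: enum_valP.
Qed.

Lemma dim_block_vectors : \dim <<block_vectors>>%VS = #|block_tops|.
Proof.
suff /eqP -> : free block_vectors by rewrite size_tuple.
apply/freeP => a E k; have := block_vectors_sum a (connect0 (mchild M) (enum_val k)).
by rewrite E mxE.
Qed.

(** This is the direction space of the flat of the marked edges: constant along marked edges means
    constant on blocks. *)
Lemma block_vectorsP (d : 'rV[R]_n) :
  d \in <<block_vectors>>%VS <-> (forall i j, mchild M j i -> d 0 i = d 0 j).
Proof.
split=> [/coord_span-> i j ji|H].
  have [r Ur rj] := mchain_top HM j; have ri := connect_trans rj (connect1 ji).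
  have Hr : r \in block_tops by rewrite inE.
  by rewrite !(block_vectors_sum _ (k := enum_rank_in Hr r)) ?enum_rankK_in.
have Hc : forall j i, connect (mchild M) j i -> d 0 i = d 0 j.
  by apply: mchain_ind => // j k i jk _ ->; apply: H.
have -> : d = \sum_(k < #|block_tops|) d 0 (enum_val k) *: block_vectors`_k.
  apply/rowP => i; have [r Ur ri] := mchain_top HM i.
  have Hr : r \in block_tops by rewrite inE.
  by rewrite (block_vectors_sum _ (k := enum_rank_in Hr r)) ?enum_rankK_in // (Hc _ _ ri).
by apply: rpred_sum => k _; apply: rpredZ; apply: memv_span; rewrite mem_nth ?size_tuple.
Qed.

End Nonempty.

(** * Affine spans and the codimension of an image *)

Section Codimension.
Import Order.TTheory GRing.Theory Num.Theory.
Local Open Scope classical_set_scope.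
Local Open Scope ring_scope.
Variable R : realType.

Lemma has_codim_uniq n (F : set 'rV[R]_n) k k' :
  has_codim F k -> has_codim F k' -> k = k'.
Proof.
have sub q q' (V V' : {vspace 'rV[R]_n}) :
    [set x | x - q \in V] = [set x | x - q' \in V'] -> (V <= V')%VS.
  move=> E; apply/subvP => d dV.
  have h z : z - q \in V -> z - q' \in V'.
    by move=> hz; have : [set x | x - q' \in V'] z by rewrite -E.
  have h1 : q + d - q' \in V' by apply: h; rewrite addrC addKr.
  have h0 : q - q' \in V' by apply: h; rewrite subrr mem0v.
  by have := rpredB h1 h0; rewrite opprB addrA subrK addrC addKr.
move=> [q [V [E1 kV]]] [q' [V' [E2 kV']]]; have E := etrans (esym E1) E2.
have VV' : V = V'.
  by apply: subv_anti; rewrite (sub _ _ _ _ E) (sub _ _ _ _ (esym E)).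
by rewrite -VV' in kV'; lia.
Qed.

Lemma affine_span_open n (F : set 'rV[R]_n) q (V : {vspace 'rV[R]_n}) :
  (forall x, F x -> x - q \in V) ->
  (forall d, d \in V -> exists2 t : R, 0 < t & F (q + t *: d)) ->
  affine_span F = [set x | x - q \in V].
Proof.
move=> sub op; apply/seteqP; split=> x /=.
  move=> [k [y [a [Fy a1 ->]]]].
  have -> : \sum_l a l *: y l - q = \sum_l a l *: (y l - q).
    by rewrite -[in LHS](scale1r q) -a1 scaler_suml -sumrB; apply: eq_bigr => l _; rewrite scalerBr.
  by apply: rpred_sum => l _; apply: rpredZ; apply: sub.
move=> xV; have [t t0 Ft] := op _ xV; have [u _ Fq] := op 0 (mem0v _).
rewrite scaler0 addr0 in Fq.
(* [x] is the combination of [q] and [q + t (x - q)] with weights [1 - 1/t] and [1/t]. *)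
exists 2%N, (fun l => if l == 0 then q else q + t *: (x - q)),
  (fun l => if l == 0 then 1 - t^-1 else t^-1).
split=> [l||]; first by case: ifP.
  by rewrite !big_ord_recl big_ord0 /= addr0 subrK.
rewrite !big_ord_recl big_ord0 /= addr0 scalerDr scalerA mulVf ?gt_eqF // scale1r.
by rewrite addrA -scalerDl subrK scale1r addrC subrK.
Qed.

Lemma small_scale (J : finType) (f g : J -> R) :
  exists2 t : R, 0 < t & forall c, 0 < f c -> t * `|g c| < f c.
Proof.
(* The scale is the inverse of [S]: the sum dominates each ratio, and the added 1 makes [S] positive
   and the bound strict. *)
pose S : R := 1 + \sum_(c | 0 < f c) `|g c| / f c.
have pos c : 0 < f c -> 0 <= `|g c| / f c.
  by move=> h; rewrite divr_ge0 // ltW.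
have S0 : 0 < S by rewrite ltr_pwDl ?ltr01 // sumr_ge0.
exists S^-1; first by rewrite invr_gt0.
move=> c fc; rewrite mulrC ltr_pdivrMr // mulrC -ltr_pdivrMr //.
by rewrite /S (bigD1 c) //= addrCA ltrDl ltr_pwDl ?ltr01 // sumr_ge0 // => ? /andP[/pos].
Qed.

Variables (m n : nat) (hm : (0 < m)%N).
Variables (I : {set 'I_n * 'I_n}) (hI : is_ideal I).
Local Notation A := (ideal_arr R m I).
Variables (M : markedtree m n) (HM : marked_trees M).

(** A direction constant on blocks preserves the equations, and finitely many strict inequalities
    survive a small step. *)
Lemma Phi_open (x d : 'rV[R]_n) : Phi A M x -> d \in <<block_vectors R M>>%VS ->
  exists2 t : R, 0 < t & Phi A M (x + t *: d).
Proof.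
move=> [H1 H2 H3] /(block_vectorsP HM) Hd.
(* [f] is the slack of each inequality at [x], and [g] its rate of change along [d]. *)
pose f (c : 'I_n * 'I_n * 'I_m.+1) : R := `|x 0 c.1.1 - x 0 c.1.2 - (c.2 : nat)%:R|.
pose g (c : 'I_n * 'I_n * 'I_m.+1) : R := d 0 c.1.1 - d 0 c.1.2.
have [t t0 Ht] := small_scale f g; exists t => //.
have bound i j (s : 'I_m.+1) (a : R) : a = x 0 i - x 0 j - (s : nat)%:R -> a != 0 ->
    - `|a| < t * d 0 i - t * d 0 j < `|a|.
  move=> ea a0; rewrite -mulrBr -ltr_norml normrM (gtr0_norm t0) ea.
  by apply: (Ht (i, j, s)); rewrite /f /= -ea normr_gt0.
split=> [i j s e ch|i j s T B o|i j s T B o]; rewrite !mxE.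
- have ji : mchild M j i by apply/(mchildP HM); exists s; split=> //; apply: mark_cadet.
  by rewrite (Hd _ _ ji) -(H1 _ _ _ e ch); lra.
- have h : x 0 i - x 0 j - (s : nat)%:R < 0 by rewrite subr_lt0; apply: H2 T B o.
  by have := bound i j s _ erefl (negbT (lt_eqF h)); rewrite (ltr0_norm h); lra.
- have h : 0 < x 0 i - x 0 j - (s : nat)%:R by rewrite subr_gt0; apply: H3 T B o.
  by have := bound i j s _ erefl (negbT (gt_eqF h)); rewrite (gtr0_norm h); lra.
Qed.

Lemma Phi_codim : has_codim (Phi A M) #|M.2|.
Proof.
have [q Pq] := Phi_nonempty R hm hI HM.
exists q, <<block_vectors R M>>%VS; split; last first.
  by rewrite (dim_block_vectors R HM) card_marks.
apply: affine_span_open => [x Px|d]; last exact: Phi_open.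
apply/(block_vectorsP HM) => i j /(mchildP HM)[s [/cadet_child c e]].
case: Px Pq => [H _ _] [H' _ _]; have := H _ _ _ e c; have := H' _ _ _ e c.
by rewrite !mxE; lra.
Qed.

End Codimension.

Theorem theorem4p3 (R : realType) (m n : nat) (hm : (0 < m)%N) (hn : (0 < n)%N)
    (I : {set 'I_n * 'I_n}) (hI : is_ideal I) :
  let A := ideal_arr R m I in
  [/\ ideal_trees m I = arr_trees m A,
      set_bij (ideal_trees m I) (faces A) (Phi A)
    & forall (M : markedtree m n) (k : nat), ideal_trees m I M ->
        (#|M.2| = k <-> has_codim (Phi A M) k)].
Proof.
have HA := @ideal_arr_hyp R m n hm I hI.
split; first exact: ideal_trees_arr_trees.
- split=> [M HM|M M' /set_mem HM /set_mem HM' E|F FF].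
  + have [x Px] := Phi_nonempty R hm hI HM.1.
    by rewrite (Phi_cell hm hI HM Px); apply: cell_face.
  + have [x Px] := Phi_nonempty R hm hI HM.1.
    by apply: (Phi_uniq hm hI HM HM' Px); rewrite -E.
  (* A face and the image of a tree are both the sign cell of any of their points, so the tree of
     one point of the face suffices. *)
  + case: (FF) => -[x Fx] _; have [M HM Px] := Phi_ex hm hI x.
    exists M => //; by rewrite (Phi_cell hm hI HM Px) (face_cell HA FF Fx).
- move=> M k HM; have c := Phi_codim R hm hI HM.1.
  by split=> [<-//|c']; apply: has_codim_uniq c c'.
Qed.
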